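(* Let $k$ be an algebraically closed field of characteristic zero and let $C$ be an irreducible smooth affine curve over $k$ with a unique place at infinity. Assume that $C$ is not rational and that the tangent sheaf $\mathcal{T}_C$ of $C$ is trivial. Then the bracket width of the simple Lie algebra $\mathrm{Vec}(C)$ is larger than or equal to two. More precisely, no nowhere vanishing vector field on $C$ can be equal to the Lie bracket of two vector fields on $C$.
   Context: $\mathrm{Vec}(C)=H^0(C,\mathcal{T}_C)$ is the Lie algebra of global algebraic vector fields on $C$ (identified with $k$-derivations of $\mathcal{O}(C)$). A smooth affine curve $C$ has a unique place at infinity if it is the complement of a single closed point in a smooth projective curve $\bar C$. For a Lie algebra $L$, the bracket width is the supremum over $a\in[L,L]$ of the smallest number $m$ such that $a=\sum_{i=1}^m[x_i,y_i]$ with $x_i,y_i\in L$. *)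

(* Defs.v *)
From HB Require Import structures.
From mathcomp Require Import all_boot all_order all_algebra.
From mathcomp Require Import fraction.
Set Implicit Arguments. Unset Strict Implicit. Unset Printing Implicit Defensive.
Import Order.TTheory GRing.Theory Num.Theory.
Local Open Scope ring_scope.

(* An affine k-variety C = Spec A is encoded by its coordinate ring A, an
   integral domain, together with the structure morphism iota : k -> A. *)
Section AffineCurve.
Variables (k : fieldType) (A : idomainType) (iota : {rmorphism k -> A}).

Inductive in_gen_alg (s : seq A) : A -> Prop :=
  | iga_gen x : x \in s -> in_gen_alg s x
  | iga_const c : in_gen_alg s (iota c)
  | iga_add x y : in_gen_alg s x -> in_gen_alg s y -> in_gen_alg s (x + y)
  | iga_mul x y : in_gen_alg s x -> in_gen_alg s y -> in_gen_alg s (x * y).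

Definition fin_gen_alg : Prop := exists s : seq A, forall x, in_gen_alg s x.

(* k-points of C = k-algebra morphisms A -> k (maximal ideals, k alg. closed). *)
Definition is_point (chi : A -> k) : Prop :=
  [/\ forall x y, chi (x + y) = chi x + chi y,
      forall x y, chi (x * y) = chi x * chi y,
      chi 1 = 1 & forall c, chi (iota c) = c].

(* Smoothness of the curve: the local ring at every point is a DVR, i.e. its
   maximal ideal ker chi is nonzero and principal after localization. *)
Definition regular_dim1 : Prop :=
  forall chi, is_point chi ->
    exists pi : A, [/\ chi pi = 0, pi != 0 &
      forall f, chi f = 0 -> exists s a : A, chi s != 0 /\ s * f = a * pi].

Definition smooth_affine_curve : Prop := fin_gen_alg /\ regular_dim1.

Definition ff := {fraction A}.
Definition toK (x : A) : ff := @FracField.tofrac A x.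
Definition constK (c : k) : ff := toK (iota c).

Definition is_place (v : ff -> int) : Prop :=
  [/\ forall x y, x != 0 -> y != 0 -> v (x * y) = v x + v y,
      forall x y, x != 0 -> y != 0 -> x + y != 0 ->
        Num.min (v x) (v y) <= v (x + y),
      forall c, c != 0 -> v (constK c) = 0 &
      exists x, x != 0 /\ v x = 1].

(* Places at infinity: those not centred on C, i.e. negative on some a in A. *)
Definition place_at_infinity (v : ff -> int) : Prop :=
  is_place v /\ exists a : A, a != 0 /\ v (toK a) < 0.

Definition unique_place_at_infinity : Prop :=
  (exists v, place_at_infinity v) /\
  forall v1 v2, place_at_infinity v1 -> place_at_infinity v2 ->
    forall x, x != 0 -> v1 x = v2 x.

Definition rational_curve : Prop :=
  exists t : ff, forall x : ff, exists P Q : {poly k},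
    (map_poly constK Q).[t] != 0 /\
    x = (map_poly constK P).[t] / (map_poly constK Q).[t].

Definition is_vf (D : A -> A) : Prop :=
  [/\ forall x y, D (x + y) = D x + D y,
      forall c x, D (iota c * x) = iota c * D x &
      forall x y, D (x * y) = x * D y + y * D x].

Definition lie (D1 D2 : A -> A) : A -> A := fun x => D1 (D2 x) - D2 (D1 x).

Definition tangent_trivial : Prop :=
  exists D0, is_vf D0 /\
    forall D, is_vf D -> exists! a : A, forall x, D x = a * D0 x.

Definition nowhere_vanishing (D : A -> A) : Prop :=
  forall chi, is_point chi -> exists f, chi (D f) != 0.

Definition sum_of_brackets (n : nat) (D : A -> A) : Prop :=
  exists ps : seq ((A -> A) * (A -> A)),
    [/\ size ps = n, foldr (fun p P => [/\ is_vf p.1, is_vf p.2 & P]) True ps &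
      forall x, D x = \sum_(p <- ps) lie p.1 p.2 x].

Definition in_derived (D : A -> A) : Prop := exists n, sum_of_brackets n D.

Definition bracket_width_ge (m : nat) : Prop :=
  exists D, in_derived D /\ forall n, (n < m)%N -> ~ sum_of_brackets n D.

End AffineCurve.

(* Main.v *)
(** Let [D0] generate the derivations of [A] and let [K] be the fraction field of [A].  In
    characteristic 0 a derivation of a subring of [K] extends to [A], with values in [K], and
    after clearing denominators it is a multiple of [D0].  Prescribing it on [k(x)] or on
    [k(x, y)] shows that [D0 x <> 0] for nonconstant [x], and that
    [K] is finite over [k(x)].  Valuation rings (through Zorn's lemma) then provide, for every
    nonconstant [x] in [A], a place where [x] has a pole, which must be the unique place at
    infinity; so the pole order [dg] there is a degree function on [A] whose degree-0 elements
    are constants, the units of [A] are constants, and every nowhere vanishing field is [c D0].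

    If [c D0 = [f D0, g D0]] then [f D0 g - g D0 f = c].  All nonconstant elements have the same
    shift [dg (D0 f) - dg f], hence [dg (f D0 g - g D0 f) = dg f + dg (D0 g) > 0] as soon as
    [f] and [g] are nonconstant of distinct degrees.  Subtracting a multiple of [f] from [g]
    reduces to the case of distinct degrees, so one of the two is constant and the other one is
    an [x] with [D0 x] constant.  Then [D0] lowers degrees, and integrating gives [A = k[x]].

    Finally, [D0] vanishes nowhere, for otherwise it could be divided by a local parameter; so
    [1] is in the ideal generated by [D0 A], and [f (D0 g) D0] is a sum of two brackets. *)

Require Import Defs.
From mathcomp Require Import all_boot all_order all_algebra.
From mathcomp Require Import fraction boolp classical_sets ring zify.
Set Implicit Arguments. Unset Strict Implicit. Unset Printing Implicit Defensive.
Import Order.TTheory GRing.Theory Num.Theory.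
Local Open Scope ring_scope.

Local Notation "x %:F" := (@FracField.tofrac _ x).

(** * Valuation rings dominating a proper ideal *)

Section Subrings.
Variable K : fieldType.
Implicit Types (S J O : K -> Prop) (p q : {poly K}).

Definition is_subring S : Prop :=
  [/\ S 1, forall x y, S x -> S y -> S (x - y) & forall x y, S x -> S y -> S (x * y)].

Definition is_proper_ideal S J : Prop :=
  [/\ forall x, J x -> S x, J 0, forall x y, J x -> J y -> J (x - y),
      forall a x, S a -> J x -> J (a * x) & ~ J 1].

Definition coefs_in S p : Prop := forall i, S p`_i.

Definition is_poly_value S (z w : K) : Prop := exists2 p, coefs_in S p & w = p.[z].

Section SubringTheory.
Variable S : K -> Prop.
Hypothesis ringS : is_subring S.

Lemma subring1 : S 1. Proof. by case: ringS. Qed.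
Lemma subringB x y : S x -> S y -> S (x - y).
Proof. by case: ringS => _ + _; apply. Qed.
Lemma subringM x y : S x -> S y -> S (x * y).
Proof. by case: ringS => _ _; apply. Qed.
Lemma subring0 : S 0.
Proof. by rewrite -(subrr 1); apply: subringB subring1 subring1. Qed.
Lemma subringN x : S x -> S (- x).
Proof. by move=> Sx; rewrite -sub0r; apply: subringB subring0 Sx. Qed.
Lemma subringD x y : S x -> S y -> S (x + y).
Proof. by move=> Sx Sy; rewrite -[y]opprK; apply: subringB Sx (subringN Sy). Qed.
Lemma subringX x n : S x -> S (x ^+ n).
Proof.
by move=> Sx; elim: n => [|n IH]; rewrite ?expr0 ?exprS; [apply: subring1|apply: subringM].
Qed.
Lemma subring_sum I (r : seq I) (P : pred I) (F : I -> K) :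
  (forall i, P i -> S (F i)) -> S (\sum_(i <- r | P i) F i).
Proof. by move=> SF; apply: big_ind => //; [apply: subring0|apply: subringD]. Qed.

Lemma coefs_inC c : S c -> coefs_in S c%:P.
Proof. by move=> Sc i; rewrite coefC; case: ifP => // _; apply: subring0. Qed.
Lemma coefs_inX : coefs_in S 'X.
Proof. by move=> i; rewrite coefX; case: (i == 1%N); [apply: subring1|apply: subring0]. Qed.
Lemma coefs_inB p q : coefs_in S p -> coefs_in S q -> coefs_in S (p - q).
Proof. by move=> Sp Sq i; rewrite coefB; apply: subringB. Qed.
Lemma coefs_inD p q : coefs_in S p -> coefs_in S q -> coefs_in S (p + q).
Proof. by move=> Sp Sq i; rewrite coefD; apply: subringD. Qed.
Lemma coefs_inM p q : coefs_in S p -> coefs_in S q -> coefs_in S (p * q).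
Proof. by move=> Sp Sq i; rewrite coefM; apply: subring_sum => j _; apply: subringM. Qed.

Lemma is_poly_value_subring z : is_subring (is_poly_value S z).
Proof.
split.
- by exists 1%:P; [apply: coefs_inC subring1 | rewrite hornerC].
- by move=> _ _ [p Sp ->] [q Sq ->]; exists (p - q); rewrite ?hornerE //; apply: coefs_inB.
- by move=> _ _ [p Sp ->] [q Sq ->]; exists (p * q); rewrite ?hornerE //; apply: coefs_inM.
Qed.

Lemma is_poly_value_base z x : S x -> is_poly_value S z x.
Proof. by move=> Sx; exists x%:P; [apply: coefs_inC | rewrite hornerC]. Qed.

Lemma is_poly_value_var z : is_poly_value S z z.
Proof. by exists 'X; [apply: coefs_inX | rewrite hornerX]. Qed.

End SubringTheory.

Section IdealTheory.
Variables (S J : K -> Prop).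
Hypotheses (ringS : is_subring S) (idJ : is_proper_ideal S J).

Lemma ideal_sub x : J x -> S x. Proof. by case: idJ => + _ _ _ _; apply. Qed.
Lemma ideal0 : J 0. Proof. by case: idJ. Qed.
Lemma ideal1 : ~ J 1. Proof. by case: idJ. Qed.
Lemma idealB x y : J x -> J y -> J (x - y).
Proof. by case: idJ => _ _ + _ _; apply. Qed.
Lemma idealM a x : S a -> J x -> J (a * x).
Proof. by case: idJ => _ _ _ + _; apply. Qed.
Lemma idealMr a x : S a -> J x -> J (x * a).
Proof. by rewrite mulrC; apply: idealM. Qed.
Lemma idealN x : J x -> J (- x).
Proof. by move=> Jx; rewrite -sub0r; apply: idealB ideal0 Jx. Qed.
Lemma idealD x y : J x -> J y -> J (x + y).
Proof. by move=> Jx Jy; rewrite -[y]opprK; apply: idealB Jx (idealN Jy). Qed.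
Lemma ideal_sum I (r : seq I) (P : pred I) (F : I -> K) :
  (forall i, P i -> J (F i)) -> J (\sum_(i <- r | P i) F i).
Proof. by move=> JF; apply: big_ind => //; [apply: ideal0|apply: idealD]. Qed.

Lemma coefs_in_ideal p : coefs_in J p -> coefs_in S p.
Proof. by move=> Jp i; apply: ideal_sub. Qed.
Lemma coefs_in_idealM p q : coefs_in S p -> coefs_in J q -> coefs_in J (p * q).
Proof. by move=> Sp Jq i; rewrite coefM; apply: ideal_sum => j _; apply: idealM. Qed.
Lemma coefs_in_idealB p q : coefs_in J p -> coefs_in J q -> coefs_in J (p - q).
Proof. by move=> Jp Jq i; rewrite coefB; apply: idealB. Qed.

Lemma is_poly_value_ideal z :
  ~ is_poly_value J z 1 -> is_proper_ideal (is_poly_value S z) (is_poly_value J z).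
Proof.
move=> not1; split => //.
- by move=> _ [p Jp ->]; exists p => //; apply: coefs_in_ideal.
- by exists 0; rewrite ?horner0 // => i; rewrite coef0; apply: ideal0.
- by move=> _ _ [p Jp ->] [q Jq ->]; exists (p - q); rewrite ?hornerE //; apply: coefs_in_idealB.
- by move=> _ _ [p Sp ->] [q Jq ->]; exists (p * q); rewrite ?hornerE //; apply: coefs_in_idealM.
Qed.
End IdealTheory.

(** The pair is a valuation ring of [K] together with its maximal ideal; carrying the ideal along
    lets Zorn's lemma act on both at once. *)
Definition is_valuation_pair O J : Prop :=
  [/\ is_subring O, is_proper_ideal O J,
      forall z, O z -> ~ J z -> O z^-1 & forall z, ~ O z -> J z^-1].

Section MaximalPair.
Variables O J : K -> Prop.
Hypotheses (ringO : is_subring O) (idJ : is_proper_ideal O J).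
Hypothesis maxOJ : forall O' J', is_subring O' -> is_proper_ideal O' J' ->
  (forall x, O x -> O' x) -> (forall x, J x -> J' x) ->
  (forall x, O' x -> O x) /\ (forall x, J' x -> J x).

Lemma one_minus_neq0 j : J j -> 1 - j != 0.
Proof.
by move=> Jj; apply: contra_notN (ideal1 idJ); rewrite subr_eq0 => /eqP ->.
Qed.

Let one_minusM i j : J i -> J j -> exists2 l, J l & (1 - i) * (1 - j) = 1 - l.
Proof.
move=> Ji Jj; exists (i + j - i * j); last by ring.
apply: idealB idJ _ _ _ _; first exact: idealD idJ _ _ Ji Jj.
by apply: (idealM idJ) => //; apply: ideal_sub idJ _ _.
Qed.

(** Maximality is applied to the localization of [O] at [1 + J], with the fractions whose numerator
    lies in [J] as ideal. That ideal is proper: [a = 1 - i] with [a] and [i] in [J] would put 1 in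
    [J]. *)
Lemma one_minus_inv j : J j -> O (1 - j)^-1.
Proof.
pose frac S (x : K) := exists a i, [/\ S a, J i & x = a / (1 - i)].
have fracE a i b l : J i -> J l ->
    a / (1 - i) - b / (1 - l) = (a * (1 - l) - b * (1 - i)) / ((1 - i) * (1 - l)).
  move=> /one_minus_neq0 ni /one_minus_neq0 nl; field; by rewrite ni nl.
have O1m i : J i -> O (1 - i).
  by move=> Ji; apply: (subringB ringO (subring1 ringO)) (ideal_sub idJ Ji).
have J00 := ideal0 idJ.
have ringF : is_subring (frac O).
  split.
  - by exists 1, 0; rewrite subr0 divr1; split=> //; apply: subring1.
  - move=> _ _ [a [i [Oa Ji ->]]] [b [l [Ob Jl ->]]]; rewrite fracE //.
    have [h Jh ->] := one_minusM Ji Jl; do 2![eexists]; split; [|exact: Jh|reflexivity].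
    by apply: (subringB ringO); apply: (subringM ringO); rewrite ?O1m //; apply: O1m.
  - move=> _ _ [a [i [Oa Ji ->]]] [b [l [Ob Jl ->]]]; rewrite mulf_div.
    have [h Jh ->] := one_minusM Ji Jl; do 2![eexists]; split; [|exact: Jh|reflexivity].
    exact: subringM.
have idF : is_proper_ideal (frac O) (frac J).
  split.
  - by move=> _ [a [i [Ja Ji ->]]]; exists a, i; split=> //; apply: ideal_sub idJ _ _.
  - by exists 0, 0; rewrite mul0r.
  - move=> _ _ [a [i [Oa Ji ->]]] [b [l [Ob Jl ->]]]; rewrite fracE //.
    have [h Jh ->] := one_minusM Ji Jl; do 2![eexists]; split; [|exact: Jh|reflexivity].
    by apply: (idealB idJ); apply: (idealMr idJ) => //; apply: O1m.
  - move=> _ _ [a [i [Oa Ji ->]]] [b [l [Ob Jl ->]]]; rewrite mulf_div.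
    have [h Jh ->] := one_minusM Ji Jl; do 2![eexists]; split; [|exact: Jh|reflexivity].
    exact: (idealM idJ).
  - move=> [a [i [Ja Ji /(congr1 ( *%R^~ (1 - i)))]]].
    rewrite mul1r mulfVK ?one_minus_neq0 // => Ea; apply: (ideal1 idJ).
    by rewrite -(subrK i 1) Ea; apply: idealD idJ _ _ _ _.
have sub S x : S x -> frac S x by exists x, 0; rewrite subr0 divr1.
move=> Jj; have [+ _] := maxOJ ringF idF (sub O) (sub J).
by apply; exists 1, j; split; rewrite ?mul1r //; apply: subring1.
Qed.

(* The relation [1 = q(1/z)] expresses [z^m], [m = deg q], through lower powers of [z] with
   coefficients in [J]; substituting it into [1 = p(z)] lowers the degree of [p]. *)
Lemma maximal_pair_no_relations n z p q : (size p + size q <= n)%N -> z != 0 ->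
  coefs_in J p -> coefs_in J q -> p.[z] = 1 -> q.[z^-1] = 1 -> False.
Proof.
elim: n z p q => [|n IH] z p q.
  by rewrite leqn0 addn_eq0 => /andP[/nilP p0 _] _ _ _ /eqP; rewrite /horner p0 eq_sym oner_eq0.
(* The situation is symmetric under exchanging [z] with its inverse and [p] with [q]. *)
wlog leqp : z p q / (size q <= size p)%N => [wl|].
  case/orP: (leq_total (size q) (size p)) => [|leqp le_n z0 Jp Jq pz qz]; first exact: wl.
  apply: (wl z^-1 q p) => //; rewrite ?invrK ?invr_eq0 //; by rewrite addnC.
move=> le_n z0 Jp Jq pz qz.
case: (ltnP 1 (size q)) => [q1|]; last first.
  move/size1_polyC => qC; apply: (ideal1 idJ); rewrite -qz qC hornerC; exact: Jq.
pose m := (size q).-1; have Em : size q = m.+1 by rewrite /m prednK // ltnW.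
pose c := (1 - q`_0)^-1; have Oc : O c by apply: one_minus_inv.
have c0 : 1 - q`_0 != 0 by apply: one_minus_neq0.
(* Multiplying [1 = q(1/z)] by [z^m] gives [(1 - q_0) z^m] as a combination of lower powers of [z];
   [c] inverts [1 - q_0]. *)
pose r := \poly_(i < m) (c * q`_(m - i)).
have Jr : coefs_in J r.
  by move=> i; rewrite coef_poly; case: ifP => // _; [apply: (idealM idJ)|apply: ideal0 idJ].
have Er : r.[z] = z ^+ m.
  rewrite horner_poly -[RHS](mulKf c0) -/c -(big_mkord predT (fun i => c * q`_(m - i) * z ^+ i)).
  under eq_bigr do rewrite -mulrA; rewrite -mulr_sumr; congr (_ * _).
  rewrite mulrBl mul1r -[X in X - _]mul1r -qz horner_coef Em big_ord_recl expr0 mulr1 mulrDl.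
  rewrite addrC addKr big_nat_rev add0n /= big_mkord mulr_suml; apply: eq_bigr => i _.
  have lt_im := ltn_ord i; rewrite subKn // /bump leq0n add1n -mulrA; congr (_ * _).
  apply: (mulIf (expf_neq0 i.+1 z0)); rewrite -exprD subnK // exprVn mulrAC mulVf ?mul1r //.
  exact: expf_neq0.
(* The subtracted polynomial vanishes at [z] and cancels the leading term of [p]; since [l] is in
   [J], the coefficients stay in [J]. *)
pose l := lead_coef p; pose p2 := p - l *: 'X^((size p).-1 - m) * ('X^m - r).
have s_p : (m < size p)%N by rewrite -Em.
have Jl : J l by apply: Jp.
have OX i : coefs_in O 'X^i.
  by move=> j; rewrite coefXn; case: (_ == _); [apply: subring1|apply: subring0].
have OZ a f : O a -> coefs_in O f -> coefs_in O (a *: f).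
  by move=> Oa Of i; rewrite coefZ; apply: subringM.
have Jp2 : coefs_in J p2.
  apply: (coefs_in_idealB idJ) => //; rewrite mulrC; apply: (coefs_in_idealM idJ).
    apply: (coefs_inB ringO) => //; exact: coefs_in_ideal idJ _ _.
  by move=> i; rewrite coefZ; apply: (idealMr idJ) => //; apply: OX.
apply: (IH z p2 q) => //; last by rewrite /p2 !hornerE Er subrr ?mulr0 ?subr0.
rewrite -ltnS; apply: leq_trans le_n; rewrite ltn_add2r.
have p_neq0 : p != 0 by rewrite -size_poly_gt0; apply: leq_ltn_trans s_p.
have szr : (size (r) <= m)%N by apply: size_poly.
set s := size p in s_p *; have Es : s = s.-1.+1 by rewrite prednK //; apply: leq_ltn_trans s_p.
rewrite {1}Es ltnS; apply/leq_sizeP => i les.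
have lems : (m <= s.-1)%N by rewrite -ltnS -Es.
rewrite /p2 mulrBr coefB coefB -scalerAl -exprD subnK // coefZ coefXn.
have -> : (l *: 'X^(s.-1 - m) * r)`_i = 0.
  rewrite -scalerAl coefZ coefXnM; case: ifP => _; rewrite ?mulr0 //.
  by rewrite nth_default ?mulr0 //; apply: leq_trans szr _; rewrite leq_subRL; lia.
rewrite subr0; have [->|ne] := eqVneq i s.-1; first by rewrite mulr1 /l lead_coefE subrr.
rewrite mulr0 subr0 nth_default // -/s Es ltn_neqAle les eq_sym ne //.
Qed.

(** For [z] in [O] outside [J], the ideal [O z + J] must contain 1, so [z] divides some [1 - j],
    which is invertible. For [z] outside [O], maximality forces 1 into [J[z]], hence not into
    [J[1/z]], so [1/z] is in [O]; it is in [J], as otherwise its inverse [z] would be in [O]. *)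
Lemma maximal_pair_valuation : is_valuation_pair O J.
Proof.
have unitO z : O z -> ~ J z -> O z^-1.
  move=> Oz Jz; pose J' x := exists a j, [/\ O a, J j & x = a * z + j].
  have [J'1|J'1] := pselect (J' 1).
    have [a [j [Oa Jj E]]] := J'1.
    have z0 : z != 0 by apply: contra_notN Jz => /eqP ->; apply: ideal0 idJ.
    have E' : a * z = 1 - j by rewrite E addrK.
    have -> : z^-1 = a * (1 - j)^-1.
      by apply: (mulIf z0); rewrite mulVf // mulrAC E' divff // one_minus_neq0.
    by apply: (subringM ringO) => //; apply: one_minus_inv.
  have J0 := ideal0 idJ; have O0 := subring0 ringO.
  have idJ' : is_proper_ideal O J'.
    split => //.
    - move=> _ [a [j [Oa Jj ->]]]; apply: (subringD ringO); first exact: subringM.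
      exact: ideal_sub idJ _ _.
    - by exists 0, 0; rewrite mul0r addr0.
    - move=> _ _ [a [j [Oa Jj ->]]] [b [i [Ob Ji ->]]]; exists (a - b), (j - i); split.
      + exact: subringB.
      + exact: (idealB idJ).
      + by ring.
    - move=> c _ Oc [a [j [Oa Jj ->]]]; exists (c * a), (c * j); split.
      + exact: subringM.
      + exact: (idealM idJ).
      + by ring.
  have [//|j Jj|_ JJ'] := maxOJ ringO idJ'; first by exists 0, j; rewrite mul0r add0r.
  by case: Jz; apply: JJ'; exists 1, 0; rewrite mul1r addr0; split=> //; apply: subring1.
split=> // z Oz.
have z0 : z != 0 by apply: contra_notN Oz => /eqP ->; apply: subring0.
have ext w : ~ is_poly_value J w 1 -> O w.
  move=> Hw; have [||+ _] := maxOJ (is_poly_value_subring ringO w) (is_poly_value_ideal idJ Hw).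
  - exact: is_poly_value_base.
  - move=> x Jx; exists x%:P; rewrite ?hornerC // => i; rewrite coefC.
    by case: ifP => // _; apply: ideal0 idJ.
  - by apply; apply: is_poly_value_var.
have OVz : O z^-1.
  apply: (ext) => -[q Jq qz]; apply: (Oz); apply: (ext) => -[p Jp pz].
  exact: (@maximal_pair_no_relations _ z p q (leqnn _)).
by apply: contrapT => nJ; apply: Oz; rewrite -[z]invrK; apply: unitO.
Qed.

End MaximalPair.

(** Chevalley's extension theorem: Zorn's lemma for pairs ordered by inclusion of both components
    yields a maximal pair. *)
Theorem valuation_pair_exists (S0 J0 : K -> Prop) :
  is_subring S0 -> is_proper_ideal S0 J0 ->
  exists O J, [/\ is_valuation_pair O J, forall x, S0 x -> O x & forall x, J0 x -> J x].
Proof.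
move=> ringS0 idJ0.
pose good (p : (K -> Prop) * (K -> Prop)) := [/\ is_subring p.1, is_proper_ideal p.1 p.2,
  forall x, S0 x -> p.1 x & forall x, J0 x -> p.2 x].
pose T := {p | good p}.
pose le (s t : T) := (forall x, (sval s).1 x -> (sval t).1 x) /\
                     (forall x, (sval s).2 x -> (sval t).2 x).
pose R (s t : T) := `[< le s t >].
have t0 : T by exists (S0, J0); split.
have [||C totC|[[O J] gOJ] maxOJ] := @ZL_preorder T t0 R.
- by move=> t; apply/asboolP.
- by move=> r s t /asboolP[a b] /asboolP[c d]; apply/asboolP; split=> x; [move/a/c|move/b/d].
- have [[s0 Cs0]|noC] := pselect (exists s, C s); last first.
    by exists t0 => s Cs; case: noC; exists s.
  (* A nonempty chain is bounded by its componentwise union; the empty one was bounded by [t0]. *)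
  pose U x := exists2 s, C s & (sval s).1 x; pose V x := exists2 s, C s & (sval s).2 x.
  have join s t : C s -> C t -> exists2 w, C w & le s w /\ le t w.
    by move=> Cs Ct; case: (totC _ _ Cs Ct) => /asboolP st; [exists t|exists s].
  have gU : good (U, V).
    have [r0 i0 S00 J00] := svalP s0.
    split=> /=; [split|split| |].
    - by exists s0 => //; apply: subring1.
    - move=> x y [s Cs sx] [t Ct ty]; have [w Cw [[sw _] [tw _]]] := join s t Cs Ct.
      by exists w => //; have [rw _ _ _] := svalP w; apply: (subringB rw); [apply: sw|apply: tw].
    - move=> x y [s Cs sx] [t Ct ty]; have [w Cw [[sw _] [tw _]]] := join s t Cs Ct.
      by exists w => //; have [rw _ _ _] := svalP w; apply: (subringM rw); [apply: sw|apply: tw].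
    - by move=> x [s Cs sx]; exists s => //; have [_ iw _ _] := svalP s; apply: (ideal_sub iw).
    - by exists s0 => //; apply: (ideal0 i0).
    - move=> x y [s Cs sx] [t Ct ty]; have [w Cw [[_ sw] [_ tw]]] := join s t Cs Ct.
      by exists w => //; have [_ iw _ _] := svalP w; apply: (idealB iw); [apply: sw|apply: tw].
    - move=> x y [s Cs sx] [t Ct ty]; have [w Cw [[sw _] [_ tw]]] := join s t Cs Ct.
      by exists w => //; have [_ iw _ _] := svalP w; apply: (idealM iw); [apply: sw|apply: tw].
    - by move=> [s Cs s1]; have [_ iw _ _] := svalP s; apply: (ideal1 iw).
    - by move=> x Sx; exists s0 => //; apply: S00.
    - by move=> x Jx; exists s0 => //; apply: J00.
  by exists (exist _ _ gU) => s Cs; apply/asboolP; split=> x /= sx; exists s.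
have [/= rO iJ SO JJ] := gOJ; exists O, J; split=> //.
apply: maximal_pair_valuation => // O' J' rO' iJ' OO' JJ'.
have g' : good (O', J') by split=> //= x; [move/SO/OO'|move/JJ/JJ'].
by have /asboolP[] : R (exist _ _ g') (exist _ _ gOJ) by apply: maxOJ; apply/asboolP; split.
Qed.

End Subrings.

(** * Extension of derivations *)

Section DerivationExtension.
Variable K : fieldType.
Hypothesis charK : [pchar K] =i pred0.

(** A [K]-valued derivation of the subring [R], encoded by a total function of which only the values
    on [R] are constrained. *)
Definition is_deriv_on (R : K -> Prop) (d : K -> K) : Prop :=
  (forall x y, R x -> R y -> d (x + y) = d x + d y) /\
  (forall x y, R x -> R y -> d (x * y) = x * d y + y * d x).

Lemma deriv_of_1 R d : is_subring R -> is_deriv_on R d -> d 1 = 0.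
Proof.
move=> ringR [_ dM]; have R1 := subring1 ringR.
by apply: (addIr (d 1)); rewrite add0r -{3}[1](mulr1 1) dM // mul1r.
Qed.

Lemma deriv_of_0 R d : is_subring R -> is_deriv_on R d -> d 0 = 0.
Proof.
move=> ringR [dD _]; have R0 := subring0 ringR.
by apply: (addrI (d 0)); rewrite -dD // !addr0.
Qed.

Section OneStep.
Variables (R : K -> Prop) (d : K -> K) (z u : K).
Hypotheses (ringR : is_subring R) (derd : is_deriv_on R d).

Let dD x y : R x -> R y -> d (x + y) = d x + d y.
Proof. by case: derd => + _; apply. Qed.
Let dM x y : R x -> R y -> d (x * y) = x * d y + y * d x.
Proof. by case: derd => _; apply. Qed.
Let R0 : R 0 := subring0 ringR.
Let d0 : d 0 = 0 := deriv_of_0 ringR derd.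

Let d_sum n (F : 'I_n -> K) : (forall i, R (F i)) -> d (\sum_i F i) = \sum_i d (F i).
Proof.
move=> RF; elim: n F RF => [|n IH] F RF; first by rewrite !big_ord0.
rewrite !big_ord_recl dD ?IH //; exact: subring_sum.
Qed.

(* The value at [p.[z]] of the extension of [d] to [R[z]] that sends [z] to [u]. *)
Definition ext_value (p : {poly K}) : K := (map_poly d p).[z] + p^`().[z] * u.

Lemma ext_valueD p q : coefs_in R p -> coefs_in R q ->
  ext_value (p + q) = ext_value p + ext_value q.
Proof.
move=> Rp Rq; rewrite /ext_value derivD.
have -> : map_poly d (p + q) = map_poly d p + map_poly d q.
  by apply/polyP => i; rewrite coefD !coef_map_id0 // coefD dD.
by rewrite !hornerD; ring.
Qed.

Lemma ext_valueM p q : coefs_in R p -> coefs_in R q ->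
  ext_value (p * q) = p.[z] * ext_value q + q.[z] * ext_value p.
Proof.
move=> Rp Rq; rewrite /ext_value derivM.
have -> : map_poly d (p * q) = p * map_poly d q + q * map_poly d p.
  apply/polyP => i; rewrite coefD (mulrC q) coef_map_id0 // !coefM d_sum => [|j]; last first.
    exact: subringM.
  rewrite -big_split; apply: eq_bigr => j _ /=.
  by rewrite !coef_map_id0 // dM // [q`__ * _]mulrC.
by rewrite !hornerE; ring.
Qed.

Lemma ext_valueC c : R c -> ext_value c%:P = d c.
Proof.
move=> Rc; rewrite /ext_value derivC horner0 mul0r addr0.
have -> : map_poly d c%:P = (d c)%:P; last by rewrite hornerC.
by apply/polyP => i; rewrite coef_map_id0 // !coefC; case: eqP.
Qed.

(** The hypothesis says that [ext_value p] depends on [p.[z]] only, so any choice of representing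
    polynomials defines the extension. *)
Lemma deriv_extend : (forall q, coefs_in R q -> q.[z] = 0 -> ext_value q = 0) ->
  exists d', [/\ is_deriv_on (is_poly_value R z) d', forall x, R x -> d' x = d x &
    d' z = u].
Proof.
move=> wd; have /choice[f Hf] : forall w, exists p,
    is_poly_value R z w -> coefs_in R p /\ w = p.[z].
  by move=> w; have [[p Rp pz]|no] := pselect (is_poly_value R z w); [exists p|exists 0].
have d'E p : coefs_in R p -> ext_value (f p.[z]) = ext_value p.
  move=> Rp; have [|Rf Ef] := Hf p.[z]; first by exists p.
  have RNp : coefs_in R (- p) by move=> i; rewrite coefN; apply: subringN.
  have E q : coefs_in R q -> ext_value (q - q) = 0.
    by move=> Rq; rewrite subrr -[0]/(0%:P) ext_valueC // d0.
  apply: (addIr (ext_value (- p))); rewrite -!ext_valueD // E // wd //.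
    by apply: coefs_inD.
  by rewrite hornerD hornerN -Ef subrr.
exists (fun w => ext_value (f w)); split.
- split=> _ _ [p Rp ->] [q Rq ->].
    by rewrite -hornerD !d'E ?ext_valueD //; apply: coefs_inD.
  by rewrite -hornerM !d'E ?ext_valueM //; apply: coefs_inM.
- move=> x Rx; rewrite -[x in LHS](hornerC x z) d'E ?ext_valueC //; exact: coefs_inC.
- rewrite -[z in LHS](hornerX z) d'E; last exact: coefs_inX.
  rewrite /ext_value derivX hornerC mul1r (_ : map_poly d 'X = 0) ?horner0 ?add0r //.
  apply/polyP => i; rewrite coef0 coef_map_id0 // coefX.
  by case: eqP; rewrite ?d0 ?(deriv_of_1 ringR derd).
Qed.

End OneStep.

Lemma deriv_extend_transcendental R d z u : is_subring R -> is_deriv_on R d ->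
  (forall q, coefs_in R q -> q.[z] = 0 -> q = 0) ->
  exists d', [/\ is_deriv_on (is_poly_value R z) d', forall x, R x -> d' x = d x & d' z = u].
Proof.
move=> ringR derd trz; apply: deriv_extend => // q Rq /(trz _ Rq) ->.
by rewrite -[0]/(0%:P) (ext_valueC _ _ ringR derd) ?(deriv_of_0 ringR derd) //; apply: subring0.
Qed.

(** If [z] is algebraic over [R], a relation [p] of least size has [p'(z) != 0] in characteristic 0,
    which determines the value at [z]. Pseudo-division by [p] then shows that this value respects
    every other relation. *)
Lemma deriv_extend_any R d z : is_subring R -> is_deriv_on R d ->
  exists d', is_deriv_on (is_poly_value R z) d' /\ forall x, R x -> d' x = d x.
Proof.
move=> ringR derd.
have [trz|] := pselect (forall q, coefs_in R q -> q.[z] = 0 -> q = 0).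
  by have [d' []] := deriv_extend_transcendental 0 ringR derd trz; exists d'.
have R0 := subring0 ringR.
move=> /existsNP[q0 /not_implyP[Rq0 /not_implyP[q0z /eqP q0n0]]].
pose P n := `[< exists2 q, [/\ coefs_in R q, q.[z] = 0 & q != 0] & size q = n >].
have exP : exists n, P n by exists (size q0); apply/asboolP; exists q0.
case: (ex_minnP exP) => m /asboolP[p [Rp pz p0] <-] minp {m exP}.
have minp' q : coefs_in R q -> q.[z] = 0 -> (size q < size p)%N -> q = 0.
  move=> Rq qz; apply: contraTeq => qn0; rewrite -leqNgt; apply: minp.
  by apply/asboolP; exists q.
have p'z : p^`().[z] != 0.
  apply/eqP => p'z; have := minp' p^`() _ p'z (lt_size_deriv p0).
  have Rp' : coefs_in R p^`().
    move=> i; rewrite coef_deriv; have := Rp i.+1; move: p`_i.+1 => c Rc.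
    elim: i.+1 => [|n IH]; first by rewrite mulr0n.
    by rewrite mulrS; apply: (subringD ringR).
  move=> /(_ Rp') /(congr1 (fun q : {poly K} => q`_((size p).-2))); rewrite coef0 coef_deriv.
  have sz1 : (1 < size p)%N.
    rewrite ltnNge; apply/negP => /size1_polyC pC; move: pz p0; rewrite pC hornerC => ->.
    by rewrite polyC0 eqxx.
  have -> : (size p).-2.+1 = (size p).-1 by move: sz1; case: (size p) => [|[]].
  move/eqP; rewrite -mulr_natr mulf_eq0 -lead_coefE lead_coef_eq0 (negbTE p0) /=.
  by move/pcharf0P: charK => ->; move: sz1; case: (size p) => [|[]].
(* The only value of the extension at [z] compatible with the relation [p.[z] = 0]. *)
pose u := - (map_poly d p).[z] / p^`().[z].
have Dp : ext_value d z u p = 0.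
  by rewrite /ext_value /u mulrC divfK // addrN.
have [|d' [H1 H2 _]] := @deriv_extend R d z u ringR derd; last by exists d'.
move=> q; elim: {q}(size q) {-2}q (leqnn (size q)) => [|n IH] q.
  rewrite leqn0 size_poly_eq0 => /eqP -> _ _; rewrite -[0]/(0%:P) (ext_valueC _ _ ringR derd) //.
  exact: deriv_of_0 ringR derd.
move=> szq Rq qz; case: (ltnP (size q) (size p)) => [lt_qp|le_pq].
  rewrite (minp' q) // -[0]/(0%:P) (ext_valueC _ _ ringR derd) //.
  exact: deriv_of_0 ringR derd.
(* The relation [b q - c X^e p] is shorter than [q], and its [ext_value] is [b] times that of [q],
   because [p], [q] and [ext_value p] all vanish at [z]. *)
pose b := lead_coef p; pose c := lead_coef q; pose e := (size q - size p)%N.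
have Rb : R b by apply: Rp.
have Rc : R c by apply: Rq.
have RX i : coefs_in R 'X^i.
  by move=> j; rewrite coefXn; case: (_ == _); [apply: subring1|apply: subring0].
have RcX : coefs_in R (- c%:P * 'X^e).
  apply: coefs_inM => //; rewrite -polyCN; apply: coefs_inC => //; exact: subringN.
have Rbq : coefs_in R (b%:P * q) by apply: coefs_inM => //; apply: coefs_inC.
have RcXp : coefs_in R (- c%:P * 'X^e * p) by apply: coefs_inM.
have : ext_value d z u (b%:P * q + - c%:P * 'X^e * p) = 0.
  apply: IH; [|exact: coefs_inD|by rewrite !hornerE qz pz !mulr0 addr0].
  have szq0 : (0 < size q)%N.
    by apply: leq_trans le_pq; rewrite size_poly_gt0.
  have Esq : size q = (e + (size p).-1).+1 by have := p0; rewrite -size_poly_gt0 /e; lia.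
  rewrite -ltnS; apply: leq_trans szq; rewrite Esq ltnS; apply/leq_sizeP => i lei.
  rewrite coefD !mulNr coefN -mulrA !coefCM coefXnM.
  have -> : (i < e)%N = false by lia.
  have [->|ne] := eqVneq i (e + (size p).-1)%N.
    by rewrite addKn /b /c !lead_coefE Esq /= mulrC addrN.
  have lt_i : (e + (size p).-1 < i)%N by rewrite ltn_neqAle eq_sym ne.
  have sp0 : (0 < size p)%N by rewrite size_poly_gt0.
  rewrite !nth_default ?mulr0 ?subr0 //; last by rewrite Esq.
  by rewrite leq_subRL; [rewrite -(prednK sp0) addnS|apply: leq_trans lei; apply: leq_addr].
have Rb' : coefs_in R b%:P by apply: coefs_inC.
rewrite (ext_valueD _ _ ringR derd) // (ext_valueM _ _ ringR derd) //.
rewrite (ext_valueM _ _ ringR derd RcX Rp).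
rewrite hornerC qz pz Dp !(mul0r, mulr0, addr0, add0r) => /eqP.
by rewrite mulf_eq0 lead_coef_eq0 (negbTE p0) => /eqP.
Qed.

Lemma deriv_extend_seq R d (s : seq K) : is_subring R -> is_deriv_on R d ->
  exists R' d', [/\ is_subring R', is_deriv_on R' d', forall x, R x -> R' x,
    forall x, x \in s -> R' x & forall x, R x -> d' x = d x].
Proof.
elim: s R d => [|z s IH] R d ringR derd; first by exists R, d; split.
have [d1 [der1 E1]] := deriv_extend_any z ringR derd.
have [R' [d' [rR' dR' sR' ss E']]] := IH _ _ (is_poly_value_subring ringR z) der1.
exists R', d'; split=> // x.
- by move=> Rx; apply: sR'; apply: is_poly_value_base.
- rewrite inE => /predU1P[->|/ss //]; apply: sR'; exact: is_poly_value_var.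
- by move=> Rx; rewrite E' ?E1 //; apply: is_poly_value_base.
Qed.

End DerivationExtension.

(** * Places and residue fields of function fields *)

Section ValuationPair.
Variables (K : fieldType) (O J : K -> Prop).
Hypothesis valOJ : is_valuation_pair O J.

Let ringO : is_subring O. Proof. by case: valOJ. Qed.
Let idJ : is_proper_ideal O J. Proof. by case: valOJ. Qed.

Definition is_vunit (z : K) : Prop := O z /\ ~ J z.

Lemma vunit_neq0 z : is_vunit z -> z != 0.
Proof. by case=> _; apply: contra_notN => /eqP ->; apply: ideal0 idJ. Qed.

Lemma vunit_inv z : is_vunit z -> is_vunit z^-1.
Proof.
move=> uz; have z0 := vunit_neq0 uz; have [Oz Jz] := uz.
have OV : O z^-1 by case: valOJ => _ _ + _; apply.
by split=> // JV; apply: (ideal1 idJ); rewrite -(divff z0); apply: (idealM idJ).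
Qed.

Lemma vunitM z w : is_vunit z -> is_vunit w -> is_vunit (z * w).
Proof.
move=> uz uw; have [Oz Jz] := uz; have [Ow Jw] := uw; split; first exact: subringM.
move=> Jzw; apply: Jw; rewrite -(mulKf (vunit_neq0 uz) w); apply: (idealM idJ) => //.
by case: (vunit_inv uz).
Qed.

Lemma vunit1 : is_vunit 1. Proof. by split; [apply: subring1|apply: ideal1 idJ]. Qed.

Lemma vunitX z n : is_vunit z -> is_vunit (z ^+ n).
Proof. by move=> uz; elim: n => [|n IH]; rewrite ?expr0 ?exprS; [apply: vunit1|apply: vunitM]. Qed.

Lemma vunit_notinV z : ~ O z -> J z^-1. Proof. by case: valOJ => _ _ _; apply. Qed.

Lemma vunit_total x y : x != 0 -> y != 0 -> O (x / y) \/ O (y / x).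
Proof.
move=> x0 y0; have [|no] := pselect (O (x / y)); [by left|right].
by rewrite -[y / x]invf_div; apply: (ideal_sub idJ); apply: vunit_notinV.
Qed.

(** Selects a term of least valuation before any value group exists: comparison of valuations is
    membership of a quotient in [O]. *)
Lemma vunit_min (I : eqType) (F : I -> K) (i : I) (s : seq I) :
  (forall j, j \in i :: s -> F j != 0) ->
  exists2 m, m \in i :: s & forall j, j \in i :: s -> O (F j / F m).
Proof.
elim: s i => [|j s IH] i nz.
  exists i; rewrite ?mem_head // => j; rewrite inE => /eqP ->.
  by rewrite divff ?nz ?mem_head //; apply: subring1.
have [l|m mj Hm] := IH j; first by move=> lj; apply: nz; rewrite inE lj orbT.
have m0 : F m != 0 by apply: nz; rewrite inE mj orbT.
have i0 : F i != 0 by apply: nz; rewrite mem_head.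
case: (vunit_total i0 m0) => Oim.
  by exists m; [rewrite inE mj orbT|move=> l /predU1P[->|/Hm]].
exists i; first exact: mem_head.
move=> l /predU1P[->|/Hm Ol]; first by rewrite divff //; apply: subring1.
by rewrite -[F l](divfK m0) -(mulrA (F l / F m)); apply: (subringM ringO).
Qed.

End ValuationPair.

Section FunctionField.
Variables (k : closedFieldType) (K : fieldType) (phi : {rmorphism k -> K}).

Definition ev (t : K) (p : {poly k}) : K := (map_poly phi p).[t].

Lemma evD t p q : ev t (p + q) = ev t p + ev t q.
Proof. by rewrite /ev rmorphD hornerD. Qed.
Lemma evB t p q : ev t (p - q) = ev t p - ev t q.
Proof. by rewrite /ev rmorphB hornerD hornerN. Qed.
Lemma evM t p q : ev t (p * q) = ev t p * ev t q.
Proof. by rewrite /ev rmorphM hornerM. Qed.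
Lemma evC t c : ev t c%:P = phi c.
Proof. by rewrite /ev map_polyC hornerC. Qed.
Lemma ev0 t : ev t 0 = 0. Proof. by rewrite /ev rmorph0 horner0. Qed.
Lemma ev1 t : ev t 1 = 1. Proof. by rewrite /ev rmorph1 hornerC. Qed.
Lemma evX t : ev t 'X = t. Proof. by rewrite /ev map_polyX hornerX. Qed.
Lemma ev_sum t I (r : seq I) (P : pred I) (F : I -> {poly k}) :
  ev t (\sum_(i <- r | P i) F i) = \sum_(i <- r | P i) ev t (F i).
Proof. by rewrite /ev rmorph_sum horner_sum. Qed.
Lemma ev_coef t n (p : {poly k}) : (size p <= n)%N -> ev t p = \sum_(i < n) phi p`_i * t ^+ i.
Proof.
move=> szp; rewrite /ev (@horner_coef_wide _ n) ?size_map_poly //.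
by apply: eq_bigr => i _; rewrite coef_map.
Qed.

Definition transcendental (t : K) : Prop := forall p, ev t p = 0 -> p = 0.

(** Over an algebraically closed field a nonzero polynomial is a product of linear factors, none of
    which vanishes at [t]. *)
Lemma nonconst_transcendental (t : K) : (forall c, t != phi c) -> transcendental t.
Proof.
move=> tc p; apply: contra_eq => p0; have [r Er] := closed_field_poly_normal p.
rewrite Er -mul_polyC evM evC mulf_neq0 ?fmorph_eq0 ?lead_coef_eq0 // /ev rmorph_prod horner_prod.
rewrite prodf_seq_neq0; apply/allP => c _ /=.
by rewrite rmorphB /= map_polyX map_polyC hornerD hornerN hornerX hornerC subr_eq0 tc.
Qed.

Lemma transcendental_neq0 t : transcendental t -> t != 0.
Proof.
move=> tr; apply/eqP => t0; have := tr 'X; rewrite evX => /(_ t0) /eqP.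
by rewrite polyX_eq0.
Qed.

Lemma transcendentalV t : transcendental t -> transcendental t^-1.
Proof.
move=> tr; apply: nonconst_transcendental => c; apply: contraTneq isT => E.
have : 'X - (c^-1)%:P = 0.
  by apply: tr; rewrite evB evX evC fmorphV -E invrK subrr.
by move/eqP; rewrite polyXsubC_eq0.
Qed.

Lemma ev_neq0 t p : transcendental t -> p != 0 -> ev t p != 0.
Proof. by move=> tr; apply: contraNneq => /tr ->. Qed.

(** The form in which finiteness of [K] over [k(t)] is used: a uniform bound on degrees, with
    denominators cleared. *)
Definition algebraic_within (N : nat) (t : K) : Prop :=
  forall z : K, exists2 c : 'I_N.+1 -> {poly k},
    exists i, c i != 0 & \sum_i ev t (c i) * z ^+ i = 0.

Lemma algebraic_withinV N t : t != 0 -> algebraic_within N t -> algebraic_within N t^-1.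
Proof.
move=> t0 alg z; have [c [i0 ci0] Ec] := alg z.
(* Reversing all coefficients at the common length [D.+1] multiplies each value by the same power
   [t^-D]. *)
pose D := \max_i size (c i).
have szc i : (size (c i) <= D.+1)%N by apply: leqW; apply: leq_bigmax.
pose c' i := \poly_(j < D.+1) (c i)`_(D - j).
exists c'.
  exists i0; apply: contra_neq ci0 => c'0; apply/polyP => j; rewrite coef0.
  case: (leqP j D) => [lejD|ltDj]; last by rewrite nth_default //; apply: leq_trans (szc _) _.
  have := congr1 (fun p : {poly k} => p`_(D - j)) c'0.
  by rewrite coef0 coef_poly ltnS leq_subr subKn.
have Ec' i : ev t^-1 (c' i) = t ^- D * ev t (c i).
  rewrite (@ev_coef _ D.+1) ?size_poly // (@ev_coef t D.+1) //.
  rewrite -(big_mkord predT (fun j => phi (c' i)`_j * t^-1 ^+ j)) big_nat_rev add0n /=.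
  rewrite big_mkord mulr_sumr; apply: eq_bigr => j _; have ltj := ltn_ord j.
  rewrite subSS coef_poly ltnS leq_subr subKn // mulrCA; congr (_ * _).
  apply: (mulIf (expf_neq0 (D - j) t0)); rewrite exprVn mulVf ?expf_neq0 // -mulrA -exprD subnKC //.
  by rewrite mulVf // expf_neq0.
transitivity (t ^- D * \sum_i ev t (c i) * z ^+ i); last by rewrite Ec mulr0.
by rewrite mulr_sumr; apply: eq_bigr => i _; rewrite Ec' mulrA.
Qed.

Section OverT.
Variables (O J : K -> Prop) (t : K) (N : nat).
Hypotheses (valOJ : is_valuation_pair O J) (Ophi : forall c, O (phi c)) (Jt : J t).
Hypotheses (trt : transcendental t) (algt : algebraic_within N t).

Let ringO : is_subring O. Proof. by case: valOJ. Qed.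
Let idJ : is_proper_ideal O J. Proof. by case: valOJ. Qed.
Let t0 : t != 0 := transcendental_neq0 trt.
Let Ot : O t := ideal_sub idJ Jt.

Lemma const_vunit c : c != 0 -> is_vunit O J (phi c).
Proof.
move=> c0; split=> // Jc; apply: (ideal1 idJ).
by rewrite -(rmorph1 phi) -(mulVf c0) rmorphM; apply: (idealM idJ).
Qed.

Lemma ev_in u p : O u -> O (ev u p).
Proof.
move=> Ou; rewrite (@ev_coef u (size p)) //; apply: (subring_sum ringO) => i _.
by apply: (subringM ringO) => //; apply: subringX.
Qed.

Lemma poly_divX (p : {poly k}) : p`_0 = 0 ->
  exists2 q, p = 'X * q & (size q <= (size p).-1)%N.
Proof.
move=> p00; exists (\poly_(i < (size p).-1) p`_i.+1); last exact: size_poly.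
apply/polyP => -[|i]; rewrite mulrC coefMX //= coef_poly; case: ifP => // /negbT.
by rewrite -leqNgt => lei; rewrite nth_default //; case: (size p) lei.
Qed.

Lemma ev_vunit u (p : {poly k}) :
  O u -> J (ev u p - phi p`_0) -> p`_0 != 0 -> is_vunit O J (ev u p).
Proof.
move=> Ou Jp p0; split; first exact: ev_in.
move=> Je; have [_] := const_vunit p0; apply; rewrite -[phi _](subKr (ev u p)).
exact: (idealB idJ).
Qed.

Lemma ev_constant_term (p : {poly k}) : J (ev t p - phi p`_0).
Proof.
have [|q E _] := @poly_divX (p - (p`_0)%:P); first by rewrite coefB coefC subrr.
by rewrite -(evC t) -evB E evM evX; apply: (idealMr idJ) => //; apply: ev_in.
Qed.

(** The exponent is the order of [p] at 0: the remaining factor has nonzero constant term, hence is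
    a unit because [t] is in [J]. *)
Lemma ev_vunit_pow (p : {poly k}) : p != 0 -> exists n, is_vunit O J (ev t p / t ^+ n).
Proof.
elim: {p}(size p) {-2}p (leqnn (size p)) => [|n IH] p szp p0.
  by case/negP: p0; rewrite -size_poly_leq0.
have [p00|p00] := eqVneq p`_0 0; last first.
  by exists 0%N; rewrite divr1; apply: ev_vunit => //; apply: ev_constant_term.
have [q Eq szq] := poly_divX p00.
have q0 : q != 0 by apply: contraNneq p0 => q0; rewrite Eq q0 mulr0.
have [|m um] := IH q _ q0; first by apply: leq_trans szq _; case: (size p) szp.
by exists m.+1; rewrite Eq evM evX exprS invfM mulrACA divff // mul1r.
Qed.

(** The residue field is [k]. Otherwise every [u - c] is a unit, hence so is every nonzero
    polynomial in [u]. But an equation for [u] over [k[t]], divided by [t] until some constant term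
    survives, reduces modulo [J] to a nonzero polynomial whose value at [u] is in [J]. *)
Lemma residue_exists u : O u -> exists c, J (u - phi c).
Proof.
move=> Ou; apply: contrapT => /forallNP no.
have unitp (p : {poly k}) : p != 0 -> is_vunit O J (ev u p).
  move=> p0; have [r Er] := closed_field_poly_normal p.
  rewrite Er -mul_polyC evM evC; apply: (vunitM valOJ).
    by apply: const_vunit; rewrite lead_coef_eq0.
  rewrite /ev rmorph_prod horner_prod; apply: big_ind => [||c _].
  - exact: vunit1.
  - exact: vunitM.
  rewrite rmorphB /= map_polyX map_polyC hornerD hornerN hornerX hornerC.
  split; [exact: (subringB ringO Ou (Ophi c))|exact: no].
have [c [i0 ci0] Ec] := algt u.
have : exists n, forall i, (size (c i) <= n)%N.
  by exists (\max_i size (c i)) => i; apply: leq_bigmax.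
case=> n; elim: n c ci0 Ec => [|n IH] c ci0 Ec szc.
  by case/negP: ci0; rewrite -size_poly_leq0 szc.
have [all0|] := pselect (forall i, (c i)`_0 = 0).
  have /choice[c' Hc'] : forall i, exists q, c i = 'X * q /\ (size q <= (size (c i)).-1)%N.
    by move=> i; have [q] := poly_divX (all0 i); exists q.
  apply: (IH c').
  - by apply: contraNneq ci0 => c0; have [-> _] := Hc' i0; rewrite c0 mulr0.
  - apply: (mulfI t0); rewrite mulr0 -[RHS]Ec mulr_sumr; apply: eq_bigr => i _.
    by have [-> _] := Hc' i; rewrite evM evX mulrA.
  - move=> i; have [_ le1] := Hc' i; apply: leq_trans le1 _.
    by move: (szc i); case: (size (c i)).
move=> /existsNP[i1 /eqP ci1].
pose p := \poly_(i < N.+1) (c (inord i))`_0.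
have p0 : p != 0.
  apply: contraNneq ci1 => /(congr1 (fun q : {poly k} => q`_i1)).
  by rewrite coef0 coef_poly ltn_ord inord_val => /eqP.
have [_] := unitp _ p0; apply.
have Ep : ev u p = \sum_i phi (c i)`_0 * u ^+ i.
  rewrite (@ev_coef _ N.+1) ?size_poly //; apply: eq_bigr => i _.
  by rewrite coef_poly ltn_ord inord_val.
rewrite -[ev u p]opprK -[- ev u p]add0r Ep -{1}Ec -sumrB; apply: (idealN idJ).
apply: (ideal_sum idJ) => i _; rewrite -mulrBl; apply: (idealMr idJ).
  exact: subringX.
exact: ev_constant_term.
Qed.

(** In an algebraic equation for [z] over [k[t]] two terms must share the least valuation; their
    quotient compares a power of [z] with a power of [t]. *)
Lemma power_vunit z : z != 0 -> exists e (n : int), [/\ (0 < e)%N, (e <= N)%N &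
  is_vunit O J (z ^+ e / t ^ n)].
Proof.
move=> z0; have [c [i0 ci0] Ec] := algt z.
pose F i := ev t (c i) * z ^+ i.
have F0 i : (F i != 0) = (c i != 0).
  rewrite mulf_eq0 expf_eq0 (negbTE z0) andbF orbF; congr negb.
  by apply/eqP/eqP => [/trt|->]; rewrite ?ev0.
pose s := [seq i <- enum 'I_N.+1 | c i != 0].
have sE i : (i \in s) = (c i != 0) by rewrite mem_filter mem_enum andbT.
have [m ms Om] : exists2 m, m \in s & forall j, j \in s -> O (F j / F m).
  case Es: s => [|i s']; first by move: (sE i0); rewrite Es ci0.
  by apply: (vunit_min valOJ) => j; rewrite -Es sE F0.
(* If all other terms had larger valuation, dividing the equation by [F m] would put 1 in [J]. *)
have [j [jm js uj]] : exists j, [/\ j != m, j \in s & is_vunit O J (F j / F m)].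
  apply: contrapT => /forallNP no; apply: (ideal1 idJ).
  have Fm0 : F m != 0 by rewrite F0 -sE.
  have : \sum_i F i / F m = 0 by rewrite -mulr_suml Ec mul0r.
  rewrite (bigD1 m) //= divff // => /eqP; rewrite addr_eq0 => /eqP ->; apply: (idealN idJ).
  apply: (ideal_sum idJ) => j jm; apply: contrapT => nJ; apply: (no j).
  have js : j \in s.
    by apply: contra_notT nJ; rewrite sE -F0 negbK => /eqP ->; rewrite mul0r; apply: ideal0 idJ.
  by split=> //; split=> //; apply: Om.
have {}ms : c m != 0 by rewrite -sE.
have {}js : c j != 0 by rewrite -sE.
have [a ua] := ev_vunit_pow js; have [b ub] := ev_vunit_pow ms.
have key (i l : 'I_N.+1) (x y : nat) : c i != 0 -> c l != 0 -> is_vunit O J (ev t (c i) / t ^+ x) ->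
    is_vunit O J (ev t (c l) / t ^+ y) -> is_vunit O J (F i / F l) -> (l < i)%N ->
    exists e (n : int), [/\ (0 < e)%N, (e <= N)%N & is_vunit O J (z ^+ e / t ^ n)].
  move=> ci cl ux uy uil lt_li; exists (i - l)%N, (y%:Z - x%:Z).
  split; rewrite ?subn_gt0 //; first by apply: leq_trans (leq_subr _ _) _; rewrite -ltnS.
  have := vunitM valOJ uil (vunitM valOJ uy (vunit_inv valOJ ux)).
  congr (is_vunit _ _ _); rewrite expfzDr // -invr_expz -!exprnP /F.
  have -> : z ^+ i = z ^+ (i - l) * z ^+ l by rewrite -exprD subnK // ltnW.
  have n1 := ev_neq0 trt ci; have n2 := ev_neq0 trt cl.
  by field; rewrite n1 n2 !expf_neq0.
case: (ltngtP j m) => [lt_jm|lt_mj|/val_inj E]; last by rewrite E eqxx in jm.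
  by apply: (key m j b a) => //; rewrite -invf_div; apply: vunit_inv.
exact: (key j m a b).
Qed.

End OverT.
End FunctionField.

(** * Discrete valuations with a zero at a given transcendental element *)

Section Places.
Variables (k : closedFieldType) (K : fieldType) (phi : {rmorphism k -> K}).

(** The conditions of [is_place], over an arbitrary field containing [k]; the value at 0 is left
    free. *)
Definition is_discrete_valuation (v : K -> int) : Prop :=
  [/\ forall x y, x != 0 -> y != 0 -> v (x * y) = v x + v y,
      forall x y, x != 0 -> y != 0 -> x + y != 0 -> Num.min (v x) (v y) <= v (x + y),
      forall c, c != 0 -> v (phi c) = 0 &
      exists x, x != 0 /\ v x = 1].

(** The values of [w] form a nonzero subgroup of the integers; dividing by its positive generator
    [d] makes the valuation surjective. *)
Lemma rescale_valuation (w : K -> int) :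
  (forall x y, x != 0 -> y != 0 -> w (x * y) = w x + w y) ->
  (forall x y, x != 0 -> y != 0 -> x + y != 0 -> Num.min (w x) (w y) <= w (x + y)) ->
  (forall c, c != 0 -> w (phi c) = 0) ->
  (exists2 x, x != 0 & 0 < w x) ->
  exists2 v, is_discrete_valuation v & forall x, x != 0 -> 0 < w x -> 0 < v x.
Proof.
move=> wM wD wC [x0 x0n0 wx0].
have w1 : w 1 = 0 by rewrite -(rmorph1 phi) wC ?oner_neq0.
have wV x : x != 0 -> w x^-1 = - w x.
  by move=> xn0; apply/eqP; rewrite -addr_eq0 -wM ?invr_eq0 // mulVf // w1.
have wX x n : x != 0 -> w (x ^+ n) = w x *+ n.
  move=> xn0; elim: n => [|n IH]; first by rewrite expr0 w1.
  by rewrite exprS wM ?expf_neq0 // IH mulrS.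
have wXz x (n : int) : x != 0 -> w (x ^ n) = n * w x.
  move=> xn0; case: n => n; first by rewrite -exprnP wX // -mulr_natl natz.
  by rewrite NegzE -invr_expz wV ?expfz_neq0 // -exprnP wX // mulNr -mulr_natl natz.
pose P n := `[< (0 < n)%N /\ exists2 x, x != 0 & w x = n%:Z >].
have exP : exists n, P n.
  by exists `|w x0|%N; apply/asboolP; split; [|exists x0 => //]; lia.
case: (ex_minnP exP) => d /asboolP[d0 [y yn0 wy]] mind.
have /choice[v Hv] : forall x, exists q : int, x != 0 -> w x = q * d%:Z.
  move=> x; exists (w x %/ d%:Z)%Z => xn0.
  have E := divz_eq (w x) d%:Z; rewrite {1}E; apply/eqP.
  rewrite -subr_eq0 addrAC subrr add0r; apply/negPn/negP => r0.
  have dz : d%:Z != 0 by lia.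
  have r_ge0 := modz_ge0 (w x) dz; have r_lt := ltz_pmod (w x) (ltac:(lia) : 0 < d%:Z).
  (* The remainder is itself a value of [w], so by minimality of [d] it is 0. *)
  have wr : w (x * (y ^ (- (w x %/ d%:Z)%Z))) = (w x %% d%:Z)%Z.
    by rewrite wM ?expfz_neq0 // wXz // wy {1}E mulNr addrAC subrr add0r.
  have : P `|(w x %% d%:Z)%Z|%N.
    apply/asboolP; split; first by lia.
    exists (x * y ^ (- (w x %/ d%:Z)%Z)); first by rewrite mulf_neq0 ?expfz_neq0.
    by rewrite wr; lia.
  by move=> /mind; lia.
have d0' : 0 < d%:Z by lia.
exists v; last by move=> x xn0; rewrite (Hv x xn0) pmulr_lgt0.
split.
- move=> x y' xn0 yn0'; apply: (mulIf (lt0r_neq0 d0')).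
  by rewrite mulrDl -!Hv ?wM ?mulf_neq0.
- move=> x y' xn0 yn0' xyn0; rewrite -(ler_pM2r d0') (minr_pMl _ _ (ltW d0')) -!Hv //; exact: wD.
- move=> c c0; apply: (mulIf (lt0r_neq0 d0')).
  by rewrite mul0r -Hv ?wC // fmorph_eq0.
- by exists y; split=> //; apply: (mulIf (lt0r_neq0 d0')); rewrite mul1r -Hv.
Qed.

(** Take a valuation ring dominating the ideal [(t)] of [k[t]]. Up to units a bounded power of each
    element is a power of [t], so valuations can be measured by integers. *)
Theorem place_exists N t : transcendental phi t -> algebraic_within phi N t ->
  exists2 v, is_discrete_valuation v & 0 < v t.
Proof.
move=> trt algt; have t0 := transcendental_neq0 trt.
pose S0 x := exists p, x = ev phi t p.
pose J0 x := exists2 p : {poly k}, p`_0 = 0 & x = ev phi t p.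
have ringS0 : is_subring S0.
  split.
  - by exists 1; rewrite ev1.
  - by move=> _ _ [p ->] [q ->]; exists (p - q); rewrite evB.
  - by move=> _ _ [p ->] [q ->]; exists (p * q); rewrite evM.
have idJ0 : is_proper_ideal S0 J0.
  split.
  - by move=> _ [p _ ->]; exists p.
  - by exists 0; rewrite ?coef0 ?ev0.
  - by move=> _ _ [p p0 ->] [q q0 ->]; exists (p - q); rewrite ?evB // coefB p0 q0 subr0.
  - by move=> _ _ [p ->] [q q0 ->]; exists (p * q); rewrite ?evM // coefM big_ord1 q0 mulr0.
  - case=> p p0 E; have /eqP : p - 1 = 0 by apply: trt; rewrite evB ev1 -E subrr.
    by rewrite subr_eq0 => /eqP p1; move/eqP: p0; rewrite p1 coef1 oner_eq0.
have [O [J [valOJ S0O J0J]]] := valuation_pair_exists ringS0 idJ0.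
have Ophi c : O (phi c) by apply: S0O; exists c%:P; rewrite evC.
have Jt : J t by apply: J0J; exists 'X; rewrite ?coefX ?evX.
have [ringO idJ _ _] := valOJ.
pose U := is_vunit O J.
have UM := vunitM valOJ; have UV := vunit_inv valOJ.
(* A common multiple of all exponents [e <= N] given by [power_vunit], so that one power serves all
   elements. *)
pose M := N`!.
have /choice[w Hw] : forall z, exists n : int, z != 0 -> U (z ^+ M / t ^ n).
  move=> z; have [->|z0] := eqVneq z 0; first by exists 0.
  have [e [n [e0 eN Ue]]] := power_vunit valOJ Ophi Jt trt algt z0.
  exists (n * (M %/ e)%N) => _.
  have <- : (z ^+ e / t ^ n) ^+ (M %/ e)%N = z ^+ M / t ^ (n * (M %/ e)%N).
    rewrite exprMn exprVn -exprM mulnC divnK ?dvdn_fact ?e0 //.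
    by rewrite [(t ^ n) ^+ _]exprnP exprz_exp.
  exact: vunitX.
have JX m : J (t ^+ m.+1).
  by rewrite exprSr; apply: (idealM idJ) => //; apply: (subringX ringO); apply: (ideal_sub idJ).
have tU n : U (t ^ n) -> n = 0.
  case: n => [[|m] //|m]; first by case=> _ []; apply: JX.
  by move=> /UV [_ []]; rewrite NegzE -invr_expz invrK; apply: JX.
have wE z n : z != 0 -> U (z ^+ M / t ^ n) -> w z = n.
  move=> z0 Un; apply/eqP; rewrite -subr_eq0; apply/eqP/tU.
  have := UM _ _ Un (UV _ (Hw z z0)); congr U.
  rewrite expfzDr // -invr_expz; have := expf_neq0 M z0.
  have := expfz_neq0 n t0; have := expfz_neq0 (w z) t0 => a1 a2 a3.
  by field; rewrite a1 a2 a3.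
have wM x y : x != 0 -> y != 0 -> w (x * y) = w x + w y.
  move=> x0 y0; apply: wE; rewrite ?mulf_neq0 //.
  have := UM _ _ (Hw x x0) (Hw y y0); congr U.
  by rewrite exprMn expfzDr // invfM; ring.
have wC c : c != 0 -> w (phi c) = 0.
  move=> c0; apply: wE; rewrite ?fmorph_eq0 // expr0z divr1.
  by apply: (vunitX valOJ); apply: const_vunit.
have wt : w t = M.
  by apply: wE => //; rewrite -exprnP divff ?expf_neq0 //; apply: (vunit1 valOJ).
have zM z : z != 0 -> exists2 u, U u & z ^+ M = u * t ^ (w z).
  by move=> z0; exists (z ^+ M / t ^ w z); [apply: Hw|rewrite divfK // expfz_neq0].
have M0 : (0 < M)%N by apply: fact_gt0.
(* This turns the ultrametric inequality into closure of [O] under addition, applied to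
   [1 + y / x]. *)
have Ow z : z != 0 -> O z <-> 0 <= w z.
  move=> z0; have [u [Ou Ju] Ez] := zM z z0; split=> [Oz|w0].
    case: (w z) Ez => // m; rewrite NegzE -invr_expz => Ez; case: Ju.
    have -> : u = z ^+ M * t ^+ m.+1 by rewrite Ez exprnP divfK // expfz_neq0.
    by apply: (idealM idJ) => //; apply: (subringX ringO).
  apply: contrapT => /(vunit_notinV valOJ) JV; apply: (ideal1 idJ).
  have -> : 1 = z^-1 * (z^-1 ^+ M.-1 * z ^+ M).
    by rewrite mulrA -exprS prednK // -exprMn mulVf // expr1n.
  have OV := ideal_sub idJ JV.
  apply: (idealMr idJ) => //; apply: (subringM ringO); first exact: (subringX ringO).
  rewrite Ez; apply: (subringM ringO) => //; case: (w z) w0 => // m _.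
  by apply: (subringX ringO); apply: (ideal_sub idJ).
have wV x : x != 0 -> w x^-1 = - w x.
  move=> xn0; apply/eqP; rewrite -addr_eq0 -wM ?invr_eq0 // mulVf //.
  by rewrite -(rmorph1 phi) wC ?oner_neq0.
have wD x y : x != 0 -> y != 0 -> x + y != 0 -> Num.min (w x) (w y) <= w (x + y).
  wlog le_xy : x y / w x <= w y => [wl|] x0 y0 xy0.
    case/orP: (le_total (w x) (w y)) => le; first exact: wl.
    by rewrite minC addrC; apply: wl => //; rewrite addrC.
  rewrite (min_idPl le_xy) -subr_ge0 -wV // -wM ?invr_eq0 //.
  apply/Ow; first by rewrite mulf_neq0 ?invr_eq0.
  rewrite mulrDl divff //; apply: (subringD ringO); first exact: subring1.
  by apply/Ow; rewrite ?mulf_neq0 ?invr_eq0 // wM ?invr_eq0 // wV // subr_ge0.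
have [|v vP vt] := rescale_valuation wM wD wC; first by exists t; rewrite // wt; lia.
by exists v => //; apply: vt; rewrite // wt; lia.
Qed.

Section ValuationPairOfPlace.
Variable v : K -> int.
Hypothesis valv : is_discrete_valuation v.

Lemma valM x y : x != 0 -> y != 0 -> v (x * y) = v x + v y.
Proof. by case: valv => + _ _ _; apply. Qed.
Lemma val_const c : c != 0 -> v (phi c) = 0.
Proof. by case: valv => _ _ + _; apply. Qed.
Lemma val1 : v 1 = 0. Proof. by rewrite -(rmorph1 phi) val_const ?oner_neq0. Qed.
Lemma valV x : x != 0 -> v x^-1 = - v x.
Proof. by move=> x0; apply/eqP; rewrite -addr_eq0 -valM ?invr_eq0 // mulVf // val1. Qed.
Lemma valN x : v (- x) = v x.
Proof.
have [->|x0] := eqVneq x 0; first by rewrite oppr0.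
rewrite -mulN1r valM ?oppr_eq0 ?oner_neq0 //.
by rewrite -(rmorph1 phi) -rmorphN val_const ?add0r // oppr_eq0 oner_neq0.
Qed.
Lemma valD m x y : x + y != 0 -> (x != 0 -> m <= v x) -> (y != 0 -> m <= v y) -> m <= v (x + y).
Proof.
case: valv => _ vD _ _; have [->|x0] := eqVneq x 0; first by rewrite add0r => y0 _ ->.
have [->|y0] := eqVneq y 0; first by rewrite addr0 => _ ->.
move=> xy0 /(_ isT) mx /(_ isT) my; apply: le_trans (vD _ _ x0 y0 xy0).
by rewrite le_min mx my.
Qed.

(** The guards [z != 0] place 0 in both predicates whatever [v 0] is. The lemma makes
    [residue_exists] available at a given place. *)
Lemma valuation_pair_of_place :
  is_valuation_pair (fun z => z != 0 -> 0 <= v z) (fun z => z != 0 -> 0 < v z).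
Proof.
split; [split|split| |].
- by rewrite val1.
- by move=> x y vx vy xy0; apply: valD => //; rewrite oppr_eq0 valN.
- move=> x y vx vy; rewrite mulf_eq0 negb_or => /andP[x0 y0].
  by rewrite valM // addr_ge0 ?vx ?vy.
- by move=> x vx /vx/ltW.
- by rewrite eqxx.
- move=> x y vx vy xy0; apply: (@lt_le_trans _ _ 1) => //.
  by apply: valD => //; rewrite oppr_eq0 valN => /vy.
- move=> x y vx vy; rewrite mulf_eq0 negb_or => /andP[x0 y0].
  by rewrite valM // ltr_wpDl ?vx ?vy.
- by move=> /(_ (oner_neq0 _)); rewrite val1 ltxx.
- move=> z vz /not_implyP[z0 /negP + _].
  by rewrite -leNgt valV // oppr_ge0.
- move=> z /not_implyP[z0 /negP + _].
  by rewrite -ltNge valV // oppr_gt0.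
Qed.

Lemma place_residue N t u : transcendental phi t -> algebraic_within phi N t -> 0 < v t ->
  u != 0 -> 0 <= v u -> exists c, u != phi c -> 0 < v (u - phi c).
Proof.
move=> trt algt vt u0 vu.
have [|//||c Hc] := @residue_exists _ _ phi _ _ t N valuation_pair_of_place _ _ trt algt u.
- by move=> c; rewrite fmorph_eq0 => c0; rewrite val_const.
- by [].
by exists c; rewrite -subr_eq0.
Qed.

End ValuationPairOfPlace.
End Places.

(** * Finiteness over [k(x)] *)

Lemma fraction_divE (A : idomainType) (z : {fraction A}) :
  exists a b : A, b != 0 /\ z = a%:F / b%:F.
Proof.
elim/quotW: z => r; exists \n_r, \d_r; have d0 := denom_ratioP r; split=> //.
apply: (mulIf (x := (\d_r)%:F)); rewrite ?tofrac_eq0 // divfK ?tofrac_eq0 //.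
rewrite /FracField.tofrac; unlock. 
rewrite -[_ * _]/(FracField.mul _ _) !piE; apply/eqmodP.
by rewrite /= FracField.equivfE /FracField.mulf !numden_Ratio ?mulr1 ?oner_neq0 // mulrC.
Qed.

Section FiniteOver.
Variables (k : closedFieldType) (K : fieldType) (phi : {rmorphism k -> K}) (x : K).
Hypothesis trx : transcendental phi x.

(* The [k(x)]-span of [e], with denominators cleared. *)
Definition in_span (I : finType) (e : I -> K) (w : K) : Prop :=
  exists2 q : {poly k}, q != 0 &
  exists p : I -> {poly k}, ev phi x q * w = \sum_i ev phi x (p i) * e i.

Section Span.
Variables (I : finType) (e : I -> K).

Lemma in_spanD w1 w2 : in_span e w1 -> in_span e w2 -> in_span e (w1 + w2).
Proof.
move=> [q1 q10 [p1 E1]] [q2 q20 [p2 E2]]; exists (q1 * q2); first by rewrite mulf_neq0.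
exists (fun i => q2 * p1 i + q1 * p2 i).
transitivity (ev phi x q2 * (ev phi x q1 * w1) + ev phi x q1 * (ev phi x q2 * w2)).
  by rewrite evM; ring.
rewrite E1 E2 !mulr_sumr -big_split; apply: eq_bigr => i _ /=.
by rewrite evD !evM; ring.
Qed.

Lemma in_spanZ p w : in_span e w -> in_span e (ev phi x p * w).
Proof.
move=> [q q0 [f E]]; exists q => //; exists (fun i => p * f i).
by rewrite mulrCA E mulr_sumr; apply: eq_bigr => i _; rewrite evM mulrA.
Qed.

Lemma in_spanZV p w : p != 0 -> in_span e (ev phi x p * w) -> in_span e w.
Proof.
move=> p0 [q q0 [f E]]; exists (q * p); first by rewrite mulf_neq0.
by exists f; rewrite evM -mulrA.
Qed.

Lemma in_span0 : in_span e 0.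
Proof.
exists 1; first exact: oner_neq0.
by exists (fun=> 0); rewrite mulr0 big1 // => i _; rewrite ev0 mul0r.
Qed.

Lemma in_span_sum J (r : seq J) (P : pred J) (F : J -> K) :
  (forall j, P j -> in_span e (F j)) -> in_span e (\sum_(j <- r | P j) F j).
Proof. by move=> H; apply: big_ind => //; [apply: in_span0|apply: in_spanD]. Qed.

Lemma in_span_basis i : in_span e (e i).
Proof.
exists 1; first exact: oner_neq0.
exists (fun j => (j == i)%:R); rewrite ev1 mul1r (bigD1 i) //= eqxx ev1 mul1r.
by rewrite big1 ?addr0 // => j /negbTE ->; rewrite ev0 mul0r.
Qed.

Lemma in_span_mul y : (forall i, in_span e (y * e i)) ->
  forall w, in_span e w -> in_span e (y * w).
Proof.
move=> H w [q q0 [p E]]; apply: (in_spanZV q0); rewrite mulrCA E mulr_sumr.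
by apply: in_span_sum => i _; rewrite mulrCA; apply: in_spanZ.
Qed.

(** There is one more power of [z] than spanning elements, so the coefficient rows are linearly
    dependent over [k[x]]. *)
Lemma in_span_dependent z : (forall n, in_span e (z ^+ n)) ->
  exists2 c : 'I_#|I|.+1 -> {poly k}, exists i, c i != 0 & \sum_i ev phi x (c i) * z ^+ i = 0.
Proof.
move=> H; have /choice[Q HQ] : forall n, exists qp : {poly k} * (I -> {poly k}),
    qp.1 != 0 /\ ev phi x qp.1 * z ^+ n = \sum_i ev phi x (qp.2 i) * e i.
  by move=> n; have [q q0 [p E]] := H n; exists (q, p).
(* A zero column is added to make the matrix square; its determinant then vanishes and gives a
   nonzero left kernel vector. *)
pose M : 'M[{poly k}]_(#|I|.+1) := \matrix_(i, j)
  if unlift ord_max j is Some l then (Q i).2 (enum_val l) else 0.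
have /det0P[v v0 vM] : \det M == 0.
  apply/eqP; rewrite (expand_det_col M ord_max) big1 // => i _.
  by rewrite mxE unlift_none mul0r.
have [i vi] : exists i, v 0 i != 0.
  apply: contrapT => /forallNP all0; case/negP: v0; apply/eqP/rowP => i.
  by rewrite mxE; apply/eqP/negPn/negP/all0.
exists (fun i => v 0 i * (Q i).1).
  by exists i; rewrite mulf_neq0 //; have [] := HQ i.
under eq_bigr => j _ do rewrite evM -mulrA (HQ j).2 mulr_sumr.
rewrite exchange_big big1 // => l _ /=.
under eq_bigr => j _ do rewrite mulrA -evM.
rewrite -mulr_suml -ev_sum; have /rowP/(_ (lift ord_max (enum_rank l))) := vM.
rewrite !mxE => E; rewrite (_ : \sum_j _ = 0) ?ev0 ?mul0r // -[RHS]E.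
by apply: eq_bigr => j _; rewrite mxE liftK enum_rankK.
Qed.

End Span.

Lemma in_span_extend (s : seq K) :
  (forall y, y \in s -> exists d (c : nat -> {poly k}),
     c d != 0 /\ \sum_(i < d.+1) ev phi x (c i) * y ^+ i = 0) ->
  exists (I : finType) (e : I -> K), in_span e 1 /\
    forall y w, y \in s -> in_span e w -> in_span e (y * w).
Proof.
elim: s => [|y s IH] H.
  by exists unit, (fun=> 1); split=> //; apply: (in_span_basis (fun=> 1) tt).
have [|I [e [e1 es]]] := IH; first by move=> z zs; apply: H; rewrite inE zs orbT.
have [d [c [cd Ec]]] := H y (mem_head _ _).
have d0 : (0 < d)%N.
  case: d cd Ec => // cd; rewrite big_ord1 expr0 mulr1 => /trx E.
  by rewrite E eqxx in cd.
(* Multiplication by [y] leaves this family only at [y^d], which the equation for [y] rewrites after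
   multiplication by the leading coefficient [c d]. *)
pose e' (il : I * 'I_d) := e il.1 * y ^+ il.2.
have shift w (l : 'I_d) : in_span e w -> in_span e' (w * y ^+ l).
  move=> [q q0 [p E]]; exists q => //; exists (fun il => if il.2 == l then p il.1 else 0).
  rewrite mulrA E mulr_suml.
  rewrite -(pair_bigA _ (fun i j => ev phi x (if j == l then p i else 0) * e' (i, j))).
  apply: eq_bigr => i _ /=; rewrite (bigD1 l) //= eqxx big1 ?addr0 ?mulrA // => j /negbTE ->.
  by rewrite ev0 mul0r.
exists (I * 'I_d)%type, e'; split.
  by rewrite -[1]mulr1 -(expr0 y); apply: (shift 1 (Ordinal d0)).
move=> z w; rewrite inE => zs; apply: in_span_mul => -[i l]; rewrite /e' /=.
case/predU1P: zs => [->|zs]; last by rewrite mulrA; apply: shift; apply: es (in_span_basis _ _).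
rewrite mulrCA -exprS; case: (ltnP l.+1 d) => [lt_ld|le_dl].
  exact: (shift _ (Ordinal lt_ld) (in_span_basis e i)).
have -> : l.+1 = d by apply/eqP; rewrite eqn_leq le_dl ltn_ord.
apply: (in_spanZV cd); rewrite mulrCA; move: Ec; rewrite big_ord_recr /= => /eqP.
rewrite addrC addr_eq0 => /eqP ->; rewrite mulrN -mulNr mulr_sumr; apply: in_span_sum => j _.
rewrite mulrCA; apply: in_spanZ; rewrite mulNr -mulrN1 -(rmorphN1 phi) -(evC phi x).
by rewrite mulrC; apply: in_spanZ; apply: shift; apply: in_span_basis.
Qed.

End FiniteOver.

(** * Elementary rules for derivations of the coordinate ring *)

Section VectorFields.
Variables (k : fieldType) (A : idomainType) (iota : {rmorphism k -> A}) (D : A -> A).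
Hypothesis vfD : is_vf iota D.

Lemma vfDr x y : D (x + y) = D x + D y. Proof. by case: vfD. Qed.
Lemma vfM x y : D (x * y) = x * D y + y * D x. Proof. by case: vfD. Qed.
Lemma vfZ c x : D (iota c * x) = iota c * D x. Proof. by case: vfD. Qed.
Lemma vf0 : D 0 = 0. Proof. by apply: (addrI (D 0)); rewrite -vfDr !addr0. Qed.
Lemma vf1 : D 1 = 0.
Proof. by apply: (addrI (D 1)); rewrite addr0 -{3}[1]mulr1 vfM !mul1r. Qed.
Lemma vf_const c : D (iota c) = 0. Proof. by rewrite -[iota c]mulr1 vfZ vf1 mulr0. Qed.
Lemma vfN x : D (- x) = - D x.
Proof. by apply: (addrI (D x)); rewrite -vfDr !subrr vf0. Qed.
Lemma vfB x y : D (x - y) = D x - D y. Proof. by rewrite vfDr vfN. Qed.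
Lemma vfX x n : D (x ^+ n.+1) = (n.+1)%:R * x ^+ n * D x.
Proof.
elim: n => [|n IH]; first by rewrite expr1 expr0 !mul1r.
by rewrite exprS vfM IH (exprS x n) -[in RHS]natr1; ring.
Qed.

Lemma vf_scale a : is_vf iota (fun x => a * D x).
Proof.
split=> [x y|c x|x y]; first by rewrite vfDr mulrDr.
  by rewrite vfZ mulrCA.
by rewrite vfM; ring.
Qed.
End VectorFields.

(** * Derivations and pole orders *)

Section Degree.
Variables (k : fieldType) (A : idomainType) (iota : {rmorphism k -> A}).
Variables (D : A -> A) (dg : A -> nat).
Hypothesis chark : [pchar k] =i pred0.
Hypothesis vfD : is_vf iota D.
Hypothesis D_eq0 : forall x, D x = 0 -> exists c, x = iota c.
Hypothesis dgM : forall x y, x != 0 -> y != 0 -> dg (x * y) = (dg x + dg y)%N.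
Hypothesis dgD : forall x y, (dg (x + y) <= maxn (dg x) (dg y))%N.
Hypothesis dg_const : forall c, dg (iota c) = 0%N.
Hypothesis dg_eq0 : forall x, dg x = 0%N -> exists c, x = iota c.
(** Leading coefficients lie in [k]. The first alternative accounts for degree 0, where the
    difference 0 also has degree 0. *)
Hypothesis dg_lead : forall x y, x != 0 -> y != 0 -> dg x = dg y ->
  exists c, x = iota c * y \/ (dg (x - iota c * y) < dg x)%N.

Lemma dg0 : dg 0 = 0%N. Proof. by rewrite -(rmorph0 iota). Qed.

Lemma dgM_le x y : (dg (x * y) <= dg x + dg y)%N.
Proof.
have [->|x0] := eqVneq x 0; first by rewrite mul0r dg0.
have [->|y0] := eqVneq y 0; first by rewrite mulr0 dg0.
by rewrite dgM.
Qed.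

Lemma dgZ c x : c != 0 -> dg (iota c * x) = dg x.
Proof.
move=> c0; have [->|x0] := eqVneq x 0; first by rewrite mulr0.
by rewrite dgM ?fmorph_eq0 // dg_const.
Qed.

Lemma dgZ_le c x : (dg (iota c * x) <= dg x)%N.
Proof. by apply: leq_trans (dgM_le _ _) _; rewrite dg_const. Qed.

Lemma dgN x : dg (- x) = dg x.
Proof. by rewrite -mulN1r -(rmorphN1 iota) dgZ // oppr_eq0 oner_neq0. Qed.

Lemma dgX x n : dg (x ^+ n) = (n * dg x)%N.
Proof.
have [->|x0] := eqVneq x 0.
  by case: n => [|n]; rewrite ?expr0 -?(rmorph1 iota) ?dg_const // expr0n dg0 muln0.
elim: n => [|n IH]; first by rewrite expr0 -(rmorph1 iota) dg_const.
by rewrite exprS dgM ?expf_neq0 // IH mulSn.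
Qed.

Lemma dg_domin x y : (dg y < dg x)%N -> dg (x + y) = dg x.
Proof.
move=> ltyx; apply/eqP; rewrite eqn_leq; apply/andP; split.
  by apply: leq_trans (dgD _ _) _; rewrite geq_max leqnn ltnW.
have := dgD (x + y) (- y); rewrite addrK dgN leq_max => /orP[//|].
by rewrite leqNgt ltyx.
Qed.

Lemma dg_gt0_neq0 x : (0 < dg x)%N -> x != 0.
Proof. by apply: contraTneq => ->; rewrite dg0. Qed.

Lemma D_neq0 x : (0 < dg x)%N -> D x != 0.
Proof. by move=> x0; apply: contraTneq x0 => /D_eq0[c ->]; rewrite dg_const. Qed.

Lemma dg_gt0_of_D x : D x != 0 -> (0 < dg x)%N.
Proof.
by rewrite lt0n; apply: contraNneq => /dg_eq0[c ->]; rewrite (vf_const vfD).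
Qed.

Lemma natr_k_neq0 n : (0 < n)%N -> n%:R != 0 :> k.
Proof. by move/pcharf0P: chark => ->; rewrite lt0n. Qed.

Lemma dg_natM n x : (0 < n)%N -> dg (n%:R * x) = dg x.
Proof. by move=> n0; rewrite -(rmorph_nat iota) dgZ // natr_k_neq0. Qed.

(* With [x] of degree [n > 0] and [y_r] of least degree in each residue class modulo [n], every
   element reduces by leading terms [c x^j y_r], on which the growth of the degree under [D]
   is controlled by finitely many values. *)
Lemma dg_D_bounded x : (0 < dg x)%N -> exists B, forall f, (dg (D f) <= dg f + B)%N.
Proof.
move=> x0; pose n := dg x.
have /choice[b Hb] : forall r, exists b, forall f, f != 0 -> dg f = r %[mod n] ->
    exists y, [/\ y != 0, (dg y <= dg f)%N, dg y = r %[mod n] & (dg (D y) <= dg y + b)%N].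
  move=> r; pose P m := `[< exists y, [/\ y != 0, dg y = m & dg y = r %[mod n]] >].
  have [exP|noP] := pselect (exists m, P m); last first.
    by exists 0%N => f f0 fr; case: noP; exists (dg f); apply/asboolP; exists f.
  case: (ex_minnP exP) => m /asboolP[y [y0 <- yr]] miny.
  exists (dg (D y)) => f f0 fr; exists y; split=> //; last exact: leq_addl.
  by apply: miny; apply/asboolP; exists f.
pose B := (dg (D x) + \max_(r < n) b r)%N.
exists B => f; elim: {f}(dg f).+1 {-2}f (ltnSn (dg f)) => // m IH f ltf.
have [->|f0] := eqVneq f 0; first by rewrite (vf0 vfD) dg0.
have rn : (dg f %% n < n)%N by rewrite ltn_mod.
have [|y [y0 yf yr Dy]] := Hb (dg f %% n)%N f f0; first by rewrite modn_mod.
have bB : (b (dg f %% n)%N <= \max_(r < n) b r)%N.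
  exact: (leq_bigmax (F := fun r : 'I_n => b r) (Ordinal rn)).
have [j Ej] : exists j, dg f = (j * n + dg y)%N.
  rewrite modn_mod in yr; exists ((dg f - dg y) %/ n)%N.
  rewrite divnK ?subnK // -eqn_mod_dvd //; exact/eqP/esym.
have xn0 := dg_gt0_neq0 x0.
pose z := x ^+ j * y.
have z0 : z != 0 by rewrite mulf_neq0 ?expf_neq0.
have dz : dg z = dg f by rewrite dgM ?expf_neq0 // dgX Ej.
have Dz : (dg (D z) <= dg f + B)%N.
  rewrite /z (vfM vfD); apply: leq_trans (dgD _ _) _; rewrite geq_max; apply/andP; split.
    by apply: leq_trans (dgM_le _ _) _; rewrite dgX -/n Ej /B; lia.
  case: j {z z0 dz} Ej => [|j] Ej; first by rewrite expr0 (vf1 vfD) mulr0 dg0.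
  apply: leq_trans (dgM_le _ _) _; rewrite (vfX vfD) -mulrA dg_natM //.
  apply: leq_trans (leq_add (leqnn _) (dgM_le _ _)) _.
  by rewrite dgX -/n Ej /B mulSn; lia.
have DZ c : (dg (D (iota c * z)) <= dg f + B)%N.
  by rewrite (vfZ vfD); apply: leq_trans (dgZ_le _ _) _.
have [c [Ef|lt]] := dg_lead f0 z0 (esym dz); first by rewrite {1}Ef.
have -> : D f = D (f - iota c * z) + D (iota c * z) by rewrite -(vfDr vfD) subrK.
apply: leq_trans (dgD _ _) _; rewrite geq_max DZ andbT.
apply: leq_trans (IH _ (leq_trans lt _)) _; first by rewrite -ltnS.
by rewrite leq_add2r ltnW.
Qed.

(** The cross powers have the common degree [dg f * dg g], so their leading terms can be
    cancelled. *)
Lemma dg_lead_powers f g : (0 < dg f)%N -> (0 < dg g)%N -> exists2 c, c != 0 &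
  let h := f ^+ dg g - iota c * g ^+ dg f in h = 0 \/ (dg h < dg f * dg g)%N.
Proof.
move=> f0 g0; have fn0 := dg_gt0_neq0 f0; have gn0 := dg_gt0_neq0 g0.
have E : dg (f ^+ dg g) = dg (g ^+ dg f) by rewrite !dgX mulnC.
have [c Hc] := dg_lead (expf_neq0 _ fn0) (expf_neq0 _ gn0) E.
have c0 : c != 0.
  apply: contraTneq isT => c0; move: Hc; rewrite c0 rmorph0 mul0r subr0 ltnn => -[/eqP|//].
  by rewrite (negbTE (expf_neq0 _ fn0)).
exists c => // h; case: Hc => [Eh|]; first by left; rewrite /h Eh subrr.
by rewrite dgX mulnC; right.
Qed.

Lemma D_powers f g c : (0 < dg f)%N -> (0 < dg g)%N ->
  D (f ^+ dg g - iota c * g ^+ dg f) =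
  (dg g)%:R * f ^+ (dg g).-1 * D f - iota c * ((dg f)%:R * g ^+ (dg f).-1 * D g).
Proof.
move=> f0 g0; rewrite (vfB vfD) (vfZ vfD) -{1}(prednK g0) -{1}(prednK f0) !(vfX vfD).
by rewrite !prednK.
Qed.

(** In the derivative of [h = f^(dg g) - c g^(dg f)] the term containing [D f] dominates, while the
    degree of [h] itself drops; so [D] shifts the degree of [h] by more than that of [f]. *)
Lemma dg_D_larger f g : (0 < dg f)%N -> (0 < dg g)%N ->
  (dg (D g) + dg f < dg (D f) + dg g)%N ->
  exists2 h, (0 < dg h)%N & (dg (D f) + dg h < dg (D h) + dg f)%N.
Proof.
move=> f0 g0 lt; have fn0 := dg_gt0_neq0 f0; have gn0 := dg_gt0_neq0 g0.
have [c c0] := dg_lead_powers f0 g0; set h := _ - _ => /= Hh.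
have Df0 := D_neq0 f0; have Dg0 := D_neq0 g0.
have Eh : D h = _ := D_powers c f0 g0.
pose m := (dg g).-1; pose n := (dg f).-1.
have Em : dg g = m.+1 by rewrite prednK. have En : dg f = n.+1 by rewrite prednK.
have d1 : dg ((dg g)%:R * f ^+ (dg g).-1 * D f) = (m * dg f + dg (D f))%N.
  by rewrite -mulrA dg_natM // dgM ?expf_neq0 // dgX.
have d2 : dg (- (iota c * ((dg f)%:R * g ^+ (dg f).-1 * D g))) = (n * dg g + dg (D g))%N.
  by rewrite dgN dgZ // -mulrA dg_natM // dgM ?expf_neq0 // dgX.
have dDh : dg (D h) = (m * dg f + dg (D f))%N.
  rewrite Eh -d1; apply: dg_domin; rewrite d1 d2; rewrite Em En in lt *; nia.
exists h.
  apply: dg_gt0_of_D; case: Hh => [h0|_]; last first.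
    apply: dg_gt0_neq0; rewrite dDh; rewrite Em En in lt *; nia.
  by move: dDh; rewrite h0 (vf0 vfD) dg0; rewrite Em En in lt *; nia.
rewrite dDh; case: Hh => [->|]; first by rewrite dg0; rewrite Em En in lt *; nia.
by rewrite Em En; nia.
Qed.

(** The shift [dg (D x) - dg x] is bounded above, so it has a maximum; an element with smaller shift
    would produce one exceeding it. *)
Lemma dg_D_shift f g : (0 < dg f)%N -> (0 < dg g)%N ->
  (dg (D f) + dg g = dg (D g) + dg f)%N.
Proof.
move=> f0 g0; have [B HB] := dg_D_bounded f0.
(* The choice of [B] prevents truncation, so minimizing [mu] maximizes the shift. *)
pose mu x := (B + dg x - dg (D x))%N.
pose P m := `[< exists2 x, (0 < dg x)%N & mu x = m >].
have exP : exists m, P m by exists (mu f); apply/asboolP; exists f.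
case: (ex_minnP exP) => m /asboolP[x x0 <-] minx.
suff E y : (0 < dg y)%N -> (dg (D x) + dg y = dg (D y) + dg x)%N.
  by have := E f f0; have := E g g0; lia.
move=> y0; have le : (mu x <= mu y)%N by apply: minx; apply/asboolP; exists y.
apply/eqP; rewrite eqn_leq; apply/andP; split; last first.
  by have := HB x; have := HB y; rewrite /mu in le; lia.
rewrite leqNgt; apply/negP => lt; have [h h0 Hh] := dg_D_larger x0 y0 lt.
have : (mu x <= mu h)%N by apply: minx; apply/asboolP; exists h.
by have := HB x; have := HB h; rewrite /mu; lia.
Qed.

(** To leading order [dg g * g * D f] equals [dg f * f * D g], as for monomials. Hence [dg g] times
    the bracket is [(dg g - dg f) * f * D g] up to lower degree. *)
Lemma dg_bracket f g : (0 < dg f)%N -> (0 < dg g)%N -> dg f != dg g ->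
  dg (f * D g - g * D f) = (dg f + dg (D g))%N.
Proof.
move=> f0 g0 ne; have fn0 := dg_gt0_neq0 f0; have gn0 := dg_gt0_neq0 g0.
have shift := dg_D_shift f0 g0; have Dg0 := D_neq0 g0.
have [c c0] := dg_lead_powers f0 g0; set h := _ - _ => /= Hh.
pose w := (dg g)%:R * (D f * g) - (dg f)%:R * (f * D g).
(* Both terms on the right inherit the drop in degree of [h], the first one through [dg_D_shift],
   which requires [h] to be nonconstant. *)
have key : iota c * g ^+ dg f * w = D h * (f * g) - (dg g)%:R * (h * (D f * g)).
  rewrite /w D_powers // /h -[in f ^+ dg g](prednK g0) -[in g ^+ dg f](prednK f0) !exprS.
  by ring.
have ltw : (dg w < dg f + dg (D g))%N.
  have [->|w0] := eqVneq w 0; first by rewrite dg0 ltn_addr.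
  have : (dg (iota c * g ^+ dg f * w) < dg f * dg g + (dg f + dg (D g)))%N.
    rewrite key; apply: leq_ltn_trans (dgD _ _) _; rewrite gtn_max dgN dg_natM //.
    apply/andP; split.
      case: (posnP (dg h)) => [/dg_eq0[a ->]|h0].
        by rewrite (vf_const vfD) mul0r dg0; lia.
      have := dg_D_shift h0 f0; case: Hh => [E|]; first by rewrite E dg0 in h0.
      by have := dgM_le (D h) (f * g); have := dgM_le f g; lia.
    case: Hh => [->|]; first by rewrite mul0r dg0; lia.
    move=> lt; apply: leq_ltn_trans (dgM_le _ _) _.
    apply: leq_ltn_trans (leq_add (leqnn _) (dgM_le _ _)) _; lia.
  rewrite -mulrA dgZ // dgM ?expf_neq0 // dgX; lia.
have fDg : dg (f * D g) = (dg f + dg (D g))%N by rewrite dgM.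
rewrite -(dg_natM _ g0).
have -> : (dg g)%:R * (f * D g - g * D f) = iota ((dg g)%:R - (dg f)%:R) * (f * D g) + - w.
  by rewrite rmorphB !rmorph_nat /w; ring.
have nz : (dg g)%:R - (dg f)%:R != 0 :> k.
  case: (ltngtP (dg f) (dg g)) ne => // lt _.
    by rewrite -natrB ?(ltnW lt) // natr_k_neq0 // subn_gt0.
  by rewrite -opprB -natrB ?(ltnW lt) // oppr_eq0 natr_k_neq0 // subn_gt0.
by rewrite dg_domin dgZ // fDg // dgN.
Qed.

(** For distinct positive degrees the bracket has positive degree, so the element of smaller degree
    is constant and the other one is the slice. Equal degrees are separated by subtracting a
    multiple of [f] from [g]. *)
Lemma const_bracket_slice f g c : c != 0 -> f * D g - g * D f = iota c ->
  exists x d, d != 0 /\ D x = iota d.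
Proof.
have slice a e x : e != 0 -> iota a * D x = iota e -> exists x d, d != 0 /\ D x = iota d.
  move=> e0 E; have a0 : a != 0.
    apply: contraNneq e0 => a0; move: E; rewrite a0 rmorph0 mul0r => /esym/eqP.
    by rewrite fmorph_eq0.
  exists x, (a^-1 * e); split; first by rewrite mulf_neq0 ?invr_eq0.
  by rewrite rmorphM -E mulrA -rmorphM mulVf // rmorph1 mul1r.
have neqcase f' g' e : e != 0 -> f' * D g' - g' * D f' = iota e -> (dg g' < dg f')%N ->
    exists x d, d != 0 /\ D x = iota d.
  move=> e0 E lt; have f0 : (0 < dg f')%N by apply: leq_ltn_trans lt.
  case: (posnP (dg g')) => [/dg_eq0[a Ea]|g0].
    move: E; rewrite Ea (vf_const vfD) mulr0 sub0r => E.
    apply: (slice a (- e) f'); first by rewrite oppr_eq0.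
    by rewrite rmorphN -E opprK.
  have := dg_bracket f0 g0 (negbT (gtn_eqF lt)); rewrite E dg_const; lia.
move=> c0 E; case: (ltngtP (dg g) (dg f)) => [|lt|eq]; first exact: neqcase E.
  apply: (neqcase g f (- c)) => //; first by rewrite oppr_eq0.
  by rewrite rmorphN -E opprB.
have fn0 : f != 0.
  apply: contraNneq c0 => f0; move: E; rewrite f0 (vf0 vfD) mul0r mulr0 subrr => /esym/eqP.
  by rewrite fmorph_eq0.
have gn0 : g != 0.
  apply: contraNneq c0 => g0; move: E; rewrite g0 (vf0 vfD) mul0r mulr0 subrr => /esym/eqP.
  by rewrite fmorph_eq0.
have [a Ha] := dg_lead gn0 fn0 eq.
have E' : f * D (g - iota a * f) - (g - iota a * f) * D f = iota c.
  by rewrite (vfB vfD) (vfZ vfD) -E; ring.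
case: Ha => [Eg|lt]; last by apply: neqcase E' _ => //; rewrite -eq.
move/eqP: E'; rewrite Eg subrr (vf0 vfD) mul0r mulr0 subrr eq_sym fmorph_eq0 => /eqP cc.
by rewrite cc eqxx in c0.
Qed.

Lemma antiderivative (p : {poly k}) : exists P, P^`() = p.
Proof.
(* At [i = 0] division by zero gives 0, which fixes the constant of integration. *)
exists (\poly_(i < (size p).+1) (p`_i.-1 / i%:R)); apply/polyP => i.
rewrite coef_deriv coef_poly ltnS; case: ltnP => [_|le]; last by rewrite mul0rn nth_default.
by rewrite -[LHS]mulr_natr divfK ?natr_k_neq0.
Qed.

Lemma vf_horner (p : {poly k}) x :
  D (map_poly iota p).[x] = (map_poly iota p^`()).[x] * D x.
Proof.
elim/poly_ind: p => [|p c IH].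
  by rewrite deriv0 !rmorph0 !horner0 (vf0 vfD) mul0r.
rewrite derivMXaddC !rmorphD !rmorphM /= map_polyX map_polyC !hornerE.
by rewrite (vfDr vfD) (vfM vfD) (vf_const vfD) IH; ring.
Qed.

(** The common shift is [- dg x], so [D y] has smaller degree and is a polynomial in [x] by
    induction; an antiderivative differs from [y] by an element killed by [D]. *)
Lemma slice_generates x d : d != 0 -> D x = iota d ->
  forall y, exists p, y = (map_poly iota p).[x].
Proof.
move=> d0 Dx y.
have x0 : (0 < dg x)%N by apply: dg_gt0_of_D; rewrite Dx fmorph_eq0.
elim: {y}(dg y).+1 {-2}y (ltnSn (dg y)) => // m IH y lty.
have const a : exists p, iota a = (map_poly iota p).[x].
  by exists a%:P; rewrite map_polyC hornerC.
case: (posnP (dg y)) => [/dg_eq0[a ->] //|y0].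
have [|q Eq] := IH (D y).
  have := dg_D_shift y0 x0; rewrite Dx dg_const add0n => E.
  by move: lty; rewrite ltnS; apply: leq_trans; lia.
have [P EP] := antiderivative (d^-1 *: q).
have [a Ea] : exists a, y - (map_poly iota P).[x] = iota a.
  apply: D_eq0; rewrite (vfB vfD) vf_horner EP map_polyZ hornerZ -Eq Dx.
  by rewrite mulrAC -rmorphM mulVf // rmorph1 mul1r subrr.
exists (P + a%:P); rewrite rmorphD hornerD /= map_polyC hornerC.
by apply/eqP; rewrite addrC -subr_eq; apply/eqP.
Qed.

Theorem const_bracket_generates f g c : c != 0 -> f * D g - g * D f = iota c ->
  exists x, forall y, exists p, y = (map_poly iota p).[x].
Proof.
move=> c0 /(const_bracket_slice c0)[x [d [d0 Dx]]].
by exists x; apply: slice_generates Dx.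
Qed.

End Degree.

(** * Curves with trivial tangent sheaf *)

Section Curve.
Variables (k : closedFieldType) (A : idomainType) (iota : {rmorphism k -> A}).
Hypothesis chark : [pchar k] =i pred0.

Definition constK_morphism : {rmorphism k -> {fraction A}} := @FracField.tofrac A \o iota.
Local Notation K := {fraction A}.
Local Notation phi := constK_morphism.

Lemma constK_morphismE c : phi c = (iota c)%:F. Proof. by []. Qed.

Definition nonconstant (x : A) : Prop := forall c, x != iota c.

Lemma nonconstant_transcendental x : nonconstant x -> transcendental phi x%:F.
Proof.
by move=> xc; apply: nonconst_transcendental => c; rewrite constK_morphismE tofrac_eq.
Qed.

Variables (s : seq A) (D0 : A -> A).
Hypothesis gens : forall x, in_gen_alg iota s x.
Hypothesis vfD0 : is_vf iota D0.
Hypothesis D0basis : forall D, is_vf iota D -> exists! a : A, forall x, D x = a * D0 x.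

Let charK : [pchar K] =i pred0.
Proof. by move=> p; rewrite (fmorph_pchar phi). Qed.

Lemma D0_scale_inj a b : (forall x, a * D0 x = b * D0 x) -> a = b.
Proof.
move=> E; have [c [_ uc]] := D0basis (vf_scale vfD0 a).
by rewrite -(uc a) // -(uc b) // => x; rewrite E.
Qed.

(* As [A] is finitely generated, [d] extends to [A] and its denominators can be cleared there. *)
Lemma deriv_multiple (R : K -> Prop) (d : K -> K) : is_subring R ->
  (forall c, R (phi c)) -> is_deriv_on R d -> (forall c, d (phi c) = 0) ->
  exists a b : A, b != 0 /\ forall x, R x%:F -> b%:F * d x%:F = (a * D0 x)%:F.
Proof.
move=> ringR Rphi derd dphi.
have [R' [d' [ringR' [dD dM] RR' sR' E']]] :=
  deriv_extend_seq charK (map (@FracField.tofrac A) s) ringR derd.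
have AR' x : R' x%:F.
  elim: (gens x) => [y ys|c|y z _ Ry _ Rz|y z _ Ry _ Rz].
  - by apply: sR'; apply: map_f.
  - exact/RR'/Rphi.
  - by rewrite tofracD; apply: subringD.
  - by rewrite tofracM; apply: subringM.
have [b b0 bs] : exists2 b, b != 0 & forall x, x \in s -> exists y, b%:F * d' x%:F = y%:F.
  elim: (s) => [|x r [b b0 IH]]; first by exists 1; rewrite ?oner_neq0.
  have [n [m [m0 E]]] := fraction_divE (d' x%:F).
  exists (b * m); first by rewrite mulf_neq0.
  move=> y /predU1P[->|/IH[z Ez]].
    by exists (b * n); rewrite !tofracM E -mulrA (mulrC m%:F) divfK ?tofrac_eq0.
  by exists (m * z); rewrite !tofracM mulrAC Ez mulrC.
have /choice[D HD] : forall x, exists y, b%:F * d' x%:F = y%:F.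
  move=> x; elim: (gens x) => [//|c|y z _ [v Ev] _ [w Ew]|y z _ [v Ev] _ [w Ew]].
  - by exists 0; rewrite -constK_morphismE E' ?dphi ?mulr0 ?tofrac0.
  - by exists (v + w); rewrite !tofracD dD // mulrDr Ev Ew.
  - by exists (y * w + z * v); rewrite tofracD !tofracM dM // mulrDr !(mulrCA b%:F) Ev Ew.
have inj : injective (@FracField.tofrac A) by move=> x y /eqP; rewrite tofrac_eq => /eqP.
have vfD : is_vf iota D.
  have DM x y : D (x * y) = x * D y + y * D x.
    by apply: inj; rewrite -HD tofracD !tofracM dM // mulrDr !(mulrCA b%:F) !HD.
  split=> // [x y|c x].
    by apply: inj; rewrite -HD !tofracD dD // mulrDr !HD.
  rewrite DM (_ : D (iota c) = 0) ?mulr0 ?addr0 //.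
  by apply: inj; rewrite -HD -constK_morphismE E' ?dphi ?mulr0 ?tofrac0.
have [a [Ea _]] := D0basis vfD.
by exists a, b; split=> // x Rx; rewrite -Ea -HD E'.
Qed.

Definition base_constants (w : K) : Prop := exists c, w = phi c.

Lemma base_constants_subring : is_subring base_constants.
Proof.
split; first by exists 1; rewrite rmorph1.
  by move=> _ _ [c ->] [d ->]; exists (c - d); rewrite rmorphB.
by move=> _ _ [c ->] [d ->]; exists (c * d); rewrite rmorphM.
Qed.

Lemma coefs_in_constants q : coefs_in base_constants q -> exists p, q = map_poly phi p.
Proof.
move=> /choice[c Hc]; exists (\poly_(i < size q) c i); apply/polyP => i.
rewrite coef_map coef_poly -[RHS]/(phi _); case: ltnP => [_|le]; first exact: Hc.
by rewrite rmorph0 nth_default.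
Qed.

Lemma zero_deriv (R : K -> Prop) : is_deriv_on R (fun=> 0).
Proof. by split=> x y _ _; rewrite ?addr0 // !mulr0 addr0. Qed.

(** The derivation [d/dx] of [k[x]] takes the value 1 at [x] and is, up to a denominator, a multiple
    of [D0]. *)
Lemma D0_nonconstant x : nonconstant x -> D0 x != 0.
Proof.
move=> xc; have tr := nonconstant_transcendental xc.
have [|d [derd dbase dx]] := deriv_extend_transcendental 1 (z := x%:F)
  base_constants_subring (zero_deriv _).
  by move=> q /coefs_in_constants[p ->] /tr ->; rewrite rmorph0.
have [||a [b [b0 E]]] := deriv_multiple (is_poly_value_subring base_constants_subring x%:F) _ derd.
- by move=> c; apply: (is_poly_value_base base_constants_subring); exists c.
- by move=> c; rewrite dbase //; exists c.
apply: contra_neq b0 => Dx0; apply/eqP; rewrite -tofrac_eq0.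
rewrite -[b%:F]mulr1 -dx E ?Dx0 ?mulr0 ?tofrac0 //.
exact: is_poly_value_var base_constants_subring _.
Qed.

(** If [y] were transcendental over [k(x)], the derivation with value 0 at [x] and 1 at [y] would be
    a multiple of [D0]; as [D0 x != 0], that multiple would be zero. *)
Lemma algebraic_dependence x y : nonconstant x -> exists d (c : nat -> {poly k}),
  c d != 0 /\ \sum_(i < d.+1) ev phi x%:F (c i) * y%:F ^+ i = 0.
Proof.
move=> xc; have trx := nonconstant_transcendental xc.
pose R := is_poly_value base_constants x%:F.
have ringR : is_subring R := is_poly_value_subring base_constants_subring x%:F.
have Rphi c : R (phi c) by apply: (is_poly_value_base base_constants_subring); exists c.
have Rx : R x%:F := is_poly_value_var base_constants_subring _.
have [tr|] := pselect (forall q, coefs_in R q -> q.[y%:F] = 0 -> q = 0).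
  have [d [derd dR dy]] := deriv_extend_transcendental 1 ringR (zero_deriv _) tr.
  have [||a [b [b0 E]]] := deriv_multiple (is_poly_value_subring ringR y%:F) _ derd.
  - by move=> c; apply: is_poly_value_base.
  - by move=> c; rewrite dR.
  have /eqP : (a * D0 x)%:F = 0 by rewrite -E ?dR ?mulr0 //; apply: is_poly_value_base.
  rewrite tofrac_eq0 mulf_eq0 (negbTE (D0_nonconstant xc)) orbF => /eqP a0.
  move: b0; rewrite -tofrac_eq0 -[b%:F]mulr1 -dy E ?a0 ?mul0r ?tofrac0 ?eqxx //.
  exact: is_poly_value_var.
move=> /existsNP[q /not_implyP[Rq /not_implyP[qy /eqP q0]]].
have /choice[c Hc] : forall i, exists p, q`_i = ev phi x%:F p.
  by move=> i; have [f /coefs_in_constants[p ->] ->] := Rq i; exists p.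
exists (size q).-1, c; split.
  apply: contraNneq q0 => c0; rewrite -lead_coef_eq0 lead_coefE Hc c0 ev0 //.
rewrite prednK ?size_poly_gt0 // -[RHS]qy horner_coef.
by apply: eq_bigr => i _; rewrite Hc.
Qed.

Lemma nonconstant_algebraic_within x : nonconstant x ->
  exists N, algebraic_within phi N x%:F.
Proof.
move=> xc; have trx := nonconstant_transcendental xc.
have [|I [e [e1 es]]] := @in_span_extend _ _ phi _ trx (map (@FracField.tofrac A) s).
  by move=> _ /mapP[y _ ->]; apply: algebraic_dependence.
have stable a w : in_span phi x%:F e w -> in_span phi x%:F e (a%:F * w).
  elim: (gens a) w => [y ys|c|y z _ Hy _ Hz|y z _ Hy _ Hz] w Hw.
  - by apply: es => //; apply: map_f.
  - by rewrite -constK_morphismE -(evC phi x%:F); apply: in_spanZ.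
  - by rewrite tofracD mulrDl; apply: in_spanD; [apply: Hy|apply: Hz].
  - by rewrite tofracM -mulrA; apply: Hy; apply: Hz.
have spanX b n : in_span phi x%:F e (b%:F ^+ n).
  by elim: n => [|n IH]; rewrite ?expr0 // exprS; apply: stable.
have spanV b : b != 0 -> in_span phi x%:F e (b%:F)^-1.
  move=> b0; have bF0 : b%:F != 0 by rewrite tofrac_eq0.
  have [c exc Ec] := in_span_dependent (spanX b).
  (* Dividing the equation of [b] by [b^(i+1)], with [i] its lowest exponent, expresses the inverse
     of [b] through nonnegative powers of [b]. *)
  have [i ci mini] : exists2 i, c i != 0 & forall j, c j != 0 -> (i <= j)%N.
    by have [i0 ci0] := exc; have := @arg_minnP _ i0 (fun i => c i != 0) (@nat_of_ord _) ci0;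
       case=> i ci mini; exists i.
  apply: (in_spanZV ci).
  have -> : ev phi x%:F (c i) * (b%:F)^-1 =
      - \sum_(j | j != i) ev phi x%:F (c j) * b%:F ^+ (j - i).-1.
    apply: (mulIf (expf_neq0 i.+1 bF0)); rewrite exprS -mulrA mulKf //.
    rewrite mulNr -[LHS]subr0 -{1}Ec (bigD1 i) //= opprD addrA subrr add0r mulr_suml.
    congr (- _); apply: eq_bigr => j ji.
    have [->|cj] := eqVneq (c j) 0; first by rewrite ev0 !mul0r.
    rewrite -mulrA -exprS -exprD; congr (_ * _ ^+ _).
    have ltij : (i < j)%N by rewrite ltn_neqAle eq_sym ji mini.
    by rewrite -addSnnS prednK ?subn_gt0 // subnK // ltnW.
  rewrite -mulN1r -(rmorphN1 phi) -(evC phi x%:F); apply: in_spanZ.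
  by apply: in_span_sum => j _; apply: in_spanZ.
exists #|I| => z; apply: in_span_dependent => n.
have [a [b [b0 ->]]] := fraction_divE z.
by rewrite exprMn exprVn -!tofracXn; apply: stable; apply: spanV; rewrite expf_neq0.
Qed.

(** A Nullstellensatz: in a valuation ring dominating [A] and [I], whose residue field is [k],
    taking residues is the required point. The nonconstant [a] plays the role of the parameter [t]
    in [residue_exists]. *)
Lemma point_exists (I : A -> Prop) a : (forall x y, I x -> I y -> I (x - y)) ->
  (forall b x, I x -> I (b * x)) -> ~ I 1 -> I a -> a != 0 ->
  exists2 chi, is_point iota chi & forall x, I x -> chi x = 0.
Proof.
move=> IB IM I1 Ia a0.
have ac : nonconstant a.
  move=> c; apply/eqP => Ea; apply: I1; have c0 : c != 0.
    by apply: contraNneq a0 => c0; rewrite Ea c0 rmorph0.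
  by rewrite -(rmorph1 iota) -(mulVf c0) rmorphM -Ea; apply: IM.
have tra := nonconstant_transcendental ac; have [N alga] := nonconstant_algebraic_within ac.
have I0 : I 0 by rewrite -(subrr a); apply: IB.
pose S0 (x : K) := exists y : A, x = y%:F.
pose J0 (x : K) := exists2 y : A, I y & x = y%:F.
have ringS0 : is_subring S0.
  split; first by exists 1; rewrite tofrac1.
    by move=> _ _ [x ->] [y ->]; exists (x - y); rewrite tofracB.
  by move=> _ _ [x ->] [y ->]; exists (x * y); rewrite tofracM.
have idJ0 : is_proper_ideal S0 J0.
  split.
  - by move=> _ [x _ ->]; exists x.
  - by exists 0; rewrite ?tofrac0.
  - by move=> _ _ [x Ix ->] [y Iy ->]; exists (x - y); rewrite ?tofracB //; apply: IB.
  - by move=> _ _ [x ->] [y Iy ->]; exists (x * y); rewrite ?tofracM //; apply: IM.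
  - case=> x Ix /eqP; rewrite -tofrac1 tofrac_eq => /eqP E; apply: I1; by rewrite E.
have [O [J [valOJ S0O J0J]]] := valuation_pair_exists ringS0 idJ0.
have OA x : O x%:F by apply: S0O; exists x.
have Ophi c : O (phi c) by apply: OA.
have Ja : J a%:F by apply: J0J; exists a.
have [ringO idJ _ _] := valOJ.
have /choice[chi Hchi] : forall x : A, exists c, J (x%:F - phi c).
  by move=> x; apply: residue_exists valOJ Ophi Ja tra alga _ (OA x).
have chiE x c : J (x%:F - phi c) -> chi x = c.
  move=> Jc; apply/eqP; rewrite -subr_eq0; apply/negPn/negP => ne.
  have [_] := const_vunit valOJ Ophi ne; apply.
  have -> : phi (chi x - c) = (x%:F - phi c) - (x%:F - phi (chi x)).
    by rewrite rmorphB opprB [RHS]addrC addrA subrK.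
  by apply: (idealB idJ).
have chi_const c : chi (iota c) = c by apply: chiE; rewrite subrr; apply: ideal0 idJ.
exists chi; last by move=> x Ix; apply: chiE; rewrite rmorph0 subr0; apply: J0J; exists x.
split=> // [x y|x y|].
- apply: chiE; rewrite tofracD rmorphD opprD addrACA; exact: (idealD idJ).
- apply: chiE; rewrite tofracM rmorphM.
  have -> : x%:F * y%:F - phi (chi x) * phi (chi y) =
      x%:F * (y%:F - phi (chi y)) + phi (chi y) * (x%:F - phi (chi x)).
    by rewrite !mulrBr [phi (chi y) * x%:F]mulrC addrA subrK [phi (chi y) * _]mulrC.
  by apply: (idealD idJ); apply: (idealM idJ).
- by rewrite -(rmorph1 iota).
Qed.

(** * The pole order at infinity as a degree function *)

Section Place.
Variable v : K -> int.
Hypothesis uniqv : unique_place_at_infinity iota.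
Hypothesis placev : place_at_infinity iota v.

Let valv : is_discrete_valuation phi v. Proof. by case: placev. Qed.

(** A place where [1/x] has a zero is not centred on the curve, hence agrees with [v]. *)
Lemma nonconstant_val_lt0 x : nonconstant x -> v x%:F < 0.
Proof.
move=> xc; have trx := nonconstant_transcendental xc.
have x0 : x%:F != 0 := transcendental_neq0 trx.
have x0' : x != 0 by rewrite -tofrac_eq0.
have [N algx] := nonconstant_algebraic_within xc.
have trV := transcendentalV trx.
have [w valw wV] := place_exists trV (algebraic_withinV x0 algx).
have wx : w x%:F < 0 by rewrite -oppr_gt0 -(valV valw).
have placew : place_at_infinity iota w by split=> //; exists x.
by have [_ uq] := uniqv; rewrite (uq _ _ placev placew).
Qed.

Lemma unit_constant x y : x * y = 1 -> exists c, x = iota c.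
Proof.
move=> xy1; apply: contrapT => /forallNP xc.
have {}xc : nonconstant x by move=> c; apply/eqP/xc.
have x0 : x != 0 by apply: contra_eq_neq xy1 => ->; rewrite mul0r eq_sym oner_neq0.
have y0 : y != 0 by apply: contra_eq_neq xy1 => ->; rewrite mulr0 eq_sym oner_neq0.
have yc : nonconstant y.
  move=> c; apply: contra_eq_neq xy1 => Ey; have c0 : c != 0.
    by apply: contraNneq y0 => c0; rewrite Ey c0 rmorph0.
  apply/eqP => xy1; have /eqP := xc c^-1; case; rewrite -[x]mulr1.
  by rewrite -(rmorph1 iota) -(divff c0) rmorphM mulrA -Ey xy1 mul1r.
have /eqP := val1 valv; rewrite -tofrac1 -xy1 tofracM (valM valv) ?tofrac_eq0 //.
have := nonconstant_val_lt0 xc; have := nonconstant_val_lt0 yc; lia.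
Qed.

(** The absolute value is [- v], since [v] is nonpositive on nonzero elements of [A]. Zero gets
    order 0 like the other constants. *)
Definition pole_order (x : A) : nat := if x == 0 then 0%N else `|v x%:F|%N.

Lemma pole_orderE x : x != 0 -> v x%:F = - (pole_order x)%:Z.
Proof.
move=> x0; rewrite /pole_order (negbTE x0).
have [[c Ec]|/forallNP xc] := pselect (exists c, x = iota c).
  rewrite Ec -constK_morphismE (val_const valv) //.
  by apply: contraNneq x0 => c0; rewrite Ec c0 rmorph0.
have : v x%:F < 0 by apply: nonconstant_val_lt0 => c; apply/eqP/xc.
lia.
Qed.

Lemma pole_order_const c : pole_order (iota c) = 0%N.
Proof.
rewrite /pole_order; case: eqVneq => // ci0; rewrite -constK_morphismE (val_const valv) //.
by rewrite -(fmorph_eq0 iota).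
Qed.

Lemma pole_order_eq0 x : pole_order x = 0%N -> exists c, x = iota c.
Proof.
move=> px; apply: contrapT => /forallNP xc.
have {}xc : nonconstant x by move=> c; apply/eqP/xc.
have x0 : x != 0 by have := xc 0; rewrite rmorph0.
by have := nonconstant_val_lt0 xc; rewrite pole_orderE // px.
Qed.

Lemma pole_orderM x y : x != 0 -> y != 0 -> pole_order (x * y) = (pole_order x + pole_order y)%N.
Proof.
move=> x0 y0; have xy0 : x * y != 0 by rewrite mulf_neq0.
have := pole_orderE xy0; rewrite tofracM (valM valv) ?tofrac_eq0 // !pole_orderE //; lia.
Qed.

Lemma pole_orderD x y : (pole_order (x + y) <= maxn (pole_order x) (pole_order y))%N.
Proof.
have [->|xy0] := eqVneq (x + y) 0; first by rewrite /pole_order eqxx.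
suff : - (maxn (pole_order x) (pole_order y))%:Z <= v (x + y)%:F by rewrite pole_orderE //; lia.
rewrite tofracD; apply: (valD valv); rewrite -?tofracD ?tofrac_eq0 //.
  by move=> x0; rewrite pole_orderE //; lia.
by move=> y0; rewrite pole_orderE //; lia.
Qed.

Lemma infinity_nonconstant : exists x, nonconstant x.
Proof.
have [_ [x [x0 vx]]] := placev; exists x => c; apply: contraTneq vx => Ex.
rewrite Ex -[toK _]/(phi c) (val_const valv) ?ltxx //.
by apply: contraNneq x0 => c0; rewrite Ex c0 rmorph0.
Qed.

(** The quotient [x / y] has valuation 0; the scalar is its residue at infinity. *)
Lemma pole_order_lead x y : x != 0 -> y != 0 -> pole_order x = pole_order y ->
  exists c, x = iota c * y \/ (pole_order (x - iota c * y) < pole_order x)%N.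
Proof.
move=> x0 y0 Exy; have [t tc] := infinity_nonconstant.
have trt := nonconstant_transcendental tc; have t0 := transcendental_neq0 trt.
have [N algt] := nonconstant_algebraic_within tc.
have trV := transcendentalV trt.
have vV : 0 < v (t%:F)^-1 by rewrite (valV valv) // oppr_gt0 nonconstant_val_lt0.
have y0F : y%:F != 0 by rewrite tofrac_eq0.
have x0F : x%:F != 0 by rewrite tofrac_eq0.
have u0 : x%:F / y%:F != 0 by rewrite mulf_neq0 ?invr_eq0.
have vu : 0 <= v (x%:F / y%:F).
  by rewrite (valM valv) ?invr_eq0 // (valV valv) // !pole_orderE // Exy subrr.
have [c Hc] := place_residue valv trV (algebraic_withinV t0 algt) vV u0 vu.
exists c; have [->|ne] := eqVneq x (iota c * y); [by left|right].
have xc0 : x - iota c * y != 0 by rewrite subr_eq0.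
have E : x%:F / y%:F - phi c = (x - iota c * y)%:F / y%:F.
  by rewrite tofracB tofracM mulrBl mulfK.
have uc : x%:F / y%:F != phi c by rewrite -subr_eq0 E mulf_neq0 ?invr_eq0 ?tofrac_eq0.
have := Hc uc; rewrite E (valM valv) ?invr_eq0 ?tofrac_eq0 // (valV valv) // !pole_orderE //; lia.
Qed.

End Place.

(** * Zeros and brackets of vector fields *)

Lemma bracket_scale (u w x : A) :
  lie (fun x => u * D0 x) (fun x => w * D0 x) x = (u * D0 w - w * D0 u) * D0 x.
Proof. by rewrite /lie !(vfM vfD0); ring. Qed.

Hypothesis regA : regular_dim1 iota.

(** At a zero of [D0] with local parameter [pi] there would be a vector field [E] with [b D0 = pi E]
    and [b] nonzero at the point. Writing [E = a D0] gives [b = a pi], which vanishes there. *)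
Lemma D0_nowhere_vanishing : nowhere_vanishing iota D0.
Proof.
move=> chi chiP; apply: contrapT => /forallNP noD.
have {}noD f : chi (D0 f) = 0 by apply/eqP/negPn/negP/noD.
have [chiD chiM chi1 chiC] := chiP.
have [pi [chipi pi0 piP]] := regA chiP.
have [b chib bs] : exists2 b, chi b != 0 & forall x, x \in s -> exists a, b * D0 x = a * pi.
  elim: (s) => [|x r [b chib IH]]; first by exists 1; rewrite ?chi1 ?oner_neq0.
  have [c [a [chic E]]] := piP _ (noD x).
  exists (b * c); first by rewrite chiM mulf_neq0.
  move=> y /predU1P[->|/IH[a' E']]; first by exists (b * a); rewrite -mulrA E mulrA.
  by exists (c * a'); rewrite mulrAC E' mulrC mulrA.
have /choice[E HE] : forall x, exists a, b * D0 x = a * pi.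
  move=> x; elim: (gens x) => [//|c|y z _ [p Ep] _ [q Eq]|y z _ [p Ep] _ [q Eq]].
  - by exists 0; rewrite (vf_const vfD0) mulr0 mul0r.
  - by exists (p + q); rewrite (vfDr vfD0) mulrDr Ep Eq mulrDl.
  - exists (y * q + z * p); rewrite (vfM vfD0) mulrDr !(mulrCA b) Ep Eq; ring.
have vfE : is_vf iota E.
  split=> [x y|c x|x y]; apply: (mulIf pi0); rewrite -HE.
  - by rewrite mulrDl -!HE (vfDr vfD0) mulrDr.
  - by rewrite -mulrA -HE (vfZ vfD0) mulrCA.
  - by rewrite mulrDl -!mulrA -!HE (vfM vfD0) mulrDr !(mulrCA b).
have [a [Ea _]] := D0basis vfE.
have Eb : b = a * pi by apply: D0_scale_inj => x; rewrite HE Ea; ring.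
by move: chib; rewrite Eb chiM chipi mulr0 eqxx.
Qed.

Hypothesis uniqA : unique_place_at_infinity iota.

Lemma D0_in_derived : in_derived iota D0.
Proof.
have [[v placev] _] := uniqA; have [x xc] := infinity_nonconstant placev.
pose I a := exists l : seq (A * A), a = \sum_(p <- l) p.1 * D0 p.2.
have IM b a : I a -> I (b * a).
  move=> [l ->]; exists [seq (b * p.1, p.2) | p <- l].
  by rewrite big_map mulr_sumr; apply: eq_bigr => p _ /=; rewrite mulrA.
have ID f : I (D0 f) by exists [:: (1, f)]; rewrite big_seq1 mul1r.
have IB a b : I a -> I b -> I (a - b).
  move=> [l ->] /(IM (-1))[l' El']; exists (l ++ l').
  by rewrite big_cat -El' mulN1r.
(* If the ideal generated by the image of [D0] were proper, [D0] would vanish at one of its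
   zeros. *)
have [I1|nI1] := pselect (I 1); last first.
  have [chi chiP kill] := point_exists IB IM nI1 (ID x) (D0_nonconstant xc).
  by have [f] := D0_nowhere_vanishing chiP; rewrite kill ?eqxx.
have [l E1] := I1; pose h := iota 2%:R^-1.
have hh : h + h = 1.
  rewrite -rmorphD -mulr2n -[X in iota X]mulr_natr mulVf ?rmorph1 //.
  by move/pcharf0P: chark => ->.
(* With [h] one half, the two brackets have coefficients [h (p1 D0 p2 - p2 D0 p1)] and
   [h D0 (p1 p2)], which add up to [p1 D0 p2]. *)
pose br (p : A * A) : seq ((A -> A) * (A -> A)) :=
  [:: (fun x => h * p.1 * D0 x, fun x => p.2 * D0 x);
      (fun x => h * D0 x, fun x => p.1 * p.2 * D0 x)].
exists (size (flatten (map br l))), (flatten (map br l)); split=> //.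
  elim: (l) => //= p r IH; split; [exact: vf_scale|exact: vf_scale|].
  by split; [exact: vf_scale|exact: vf_scale|].
move=> y; rewrite -[LHS]mul1r E1 big_flatten big_map mulr_suml; apply: eq_bigr => p _.
rewrite /br big_cons big_seq1 /= !bracket_scale (vfM vfD0 p.1) (vfM vfD0 h) (vf_const vfD0).
rewrite -[p.1 * D0 p.2 in LHS]mul1r -hh; ring.
Qed.

(** A nonconstant [u] is not a unit, so the ideal it generates has a zero, where the field
    vanishes. *)
Lemma nowhere_vanishing_const u : nowhere_vanishing iota (fun x => u * D0 x) ->
  exists2 c, c != 0 & u = iota c.
Proof.
move=> nv; have [[v placev] _] := uniqA; have [x xc] := infinity_nonconstant placev.
have x0 : x != 0 by have := xc 0; rewrite rmorph0.
pose I a b := exists c : A, b = c * a.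
have IB a y z : I a y -> I a z -> I a (y - z).
  by move=> [b ->] [c ->]; exists (b - c); rewrite mulrBl.
have IM a b y : I a y -> I a (b * y) by move=> [c ->]; exists (b * c); rewrite mulrA.
have Ia a : I a a by exists 1; rewrite mul1r.
have point a : a != 0 -> ~ (exists c, a = iota c) -> exists2 chi, is_point iota chi & chi a = 0.
  move=> a0 anc; have [[b E]|chi chiP kill] := point_exists (@IB a) (IM a) _ (Ia a) a0.
    by apply: anc; apply: (unit_constant uniqA placev (y := b)); rewrite mulrC.
  by exists chi => //; apply: kill.
have [chi0 chi0P _] : exists2 chi, is_point iota chi & chi x = 0.
  by apply: point => // -[c /eqP]; rewrite (negbTE (xc c)).
have u0 : u != 0.
  apply/eqP => u0; have [f] := nv _ chi0P; rewrite u0 mul0r.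
  by have [_ _ _ chiC] := chi0P; rewrite -(rmorph0 iota) chiC eqxx.
have [[c Ec]|unc] := pselect (exists c, u = iota c).
  by exists c => //; apply: contraNneq u0 => c0; rewrite Ec c0 rmorph0.
have [chi chiP chiu] := point u u0 unc.
by have [f] := nv _ chiP; have [_ chiM _ _] := chiP; rewrite chiM chiu mul0r eqxx.
Qed.

Lemma nowhere_vanishing_not_bracket D D1 D2 : ~ rational_curve iota ->
  is_vf iota D -> nowhere_vanishing iota D -> is_vf iota D1 -> is_vf iota D2 ->
  ~ forall x, D x = lie D1 D2 x.
Proof.
move=> nrat vfD nv vf1 vf2 ED; apply: nrat.
have [[v placev] _] := uniqA.
have [u [Eu _]] := D0basis vfD; have [f [Ef _]] := D0basis vf1; have [g [Eg _]] := D0basis vf2.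
have [c c0 Ec] : exists2 c, c != 0 & u = iota c.
  by apply: nowhere_vanishing_const => chi /nv[y]; rewrite Eu; exists y.
have Efg : f * D0 g - g * D0 f = iota c.
  rewrite -Ec; apply: D0_scale_inj => x; rewrite -bracket_scale -Eu ED /lie.
  by rewrite !Ef !Eg.
have D_eq0 x : D0 x = 0 -> exists c, x = iota c.
  move=> Dx; apply: contrapT => /forallNP xc; have := @D0_nonconstant x.
  by rewrite Dx eqxx => H; have : false by apply: H => a; apply/eqP/xc.
have [x Hx] := const_bracket_generates chark vfD0 D_eq0 (pole_orderM uniqA placev)
  (pole_orderD uniqA placev) (pole_order_const placev) (pole_order_eq0 uniqA placev)
  (pole_order_lead uniqA placev) c0 Efg.
exists x%:F => z; have [a [b [b0 ->]]] := fraction_divE z.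
have [P EP] := Hx a; have [Q EQ] := Hx b; exists P, Q.
have evE p : (map_poly (constK iota) p).[x%:F] = ((map_poly iota p).[x])%:F.
  by rewrite -horner_map -map_poly_comp.
by rewrite !evE -EP -EQ tofrac_eq0.
Qed.

End Curve.

Theorem theorem3p3 (k : closedFieldType) (A : idomainType)
    (iota : {rmorphism k -> A}) :
  [pchar k] =i pred0 ->
  smooth_affine_curve iota ->
  unique_place_at_infinity iota ->
  ~ rational_curve iota ->
  tangent_trivial iota ->
  bracket_width_ge iota 2 /\
  (forall D, is_vf iota D -> nowhere_vanishing iota D ->
     ~ exists D1 D2, [/\ is_vf iota D1, is_vf iota D2 &
                         forall x, D x = lie D1 D2 x]).
Proof.
move=> chark [[s gens] regA] uniqA nrat [D0 [vfD0 D0basis]].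
have main D D1 D2 :=
  @nowhere_vanishing_not_bracket k A iota chark s D0 gens vfD0 D0basis uniqA D D1 D2 nrat.
split; last by move=> D vfD nv [D1 [D2 [vf1 vf2 E]]]; apply: main vfD nv vf1 vf2 E.
have nv0 := D0_nowhere_vanishing gens vfD0 D0basis regA.
(* The generator itself has width at least two: it is not the empty sum, being nonzero at a
   nonconstant [x], and [main] excludes a single bracket. *)
exists D0; split; first exact: (D0_in_derived chark gens vfD0 D0basis regA uniqA).
have [[v placev] _] := uniqA; have [x xc] := infinity_nonconstant placev.
case=> [|[|//]] _ [ps [sz vfs E]].
  have := D0_nonconstant chark gens D0basis xc; rewrite E.
  by rewrite (size0nil sz) big_nil eqxx.
case: ps sz vfs E => [|[D1 D2] [|]] //= _ [vf1 vf2 _] E.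
by apply: (main D0 D1 D2) => // y; rewrite E big_seq1.
Qed.
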